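(* For each real $m>0$ there exists a constant $\mathrm{const}(m)$, depending only on $m$, such that the following holds. Let $B$ be a Banach space, $X$ a metric space, $Y\subset X$ a closed subset, and $f:Y\to B$ a continuous map with $f(Y)$ compact. Then $$\mathcal{F}_{m+1}(f,X,B)\le \mathrm{const}(m)\,\mathrm{HC}_m(f(Y))^{\frac{m+1}{m}},$$ where one can take $\mathrm{const}(m)=(100(m+1))^{m+1}$.
   Context: For a metric space $Z$, a real $m>0$ and $V\subset Z$, the $m$-dimensional Hausdorff content $\mathrm{HC}_m(V)$ is the infimum of $\sum_i r_i^m$ over all coverings of $V$ by countably many closed metric balls $B(x_i,r_i)$ in $Z$. Here $\mathrm{HC}$ of subsets of $B$ is computed with balls of $B$. For metric spaces $X,B$, subsets $Y\subset X$, $U\subset B$ and a continuous map $f:Y\to U$, $\mathcal{F}_m(f,X,U)=\inf\{\mathrm{HC}_m(F(X))\}$, where the infimum is over all continuous maps $F:X\to U$ with $F|_Y=f$; it is $\infty$ if no such $F$ exists. The Banach space $B$ may be infinite-dimensional and $m$ need not be an integer. *)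

(* Defs.v *)
From HB Require Import structures.
From mathcomp Require Import all_boot all_order all_algebra.
From mathcomp Require Import all_classical all_reals all_analysis.
Import Order.TTheory GRing.Theory Num.Theory.
Import numFieldNormedType.Exports.

Set Implicit Arguments.
Unset Strict Implicit.
Unset Printing Implicit Defensive.

Local Open Scope classical_set_scope.
Local Open Scope ring_scope.

(* The library does not derive [metricType] from a norm; this is the metric
   |y - x|, on top of the topology that the normed module already carries. *)
Section norm_metric.
Context {R : realType} {B : completeNormedModType R}.

Let ndist (x y : B) : R := `|y - x|.

Let ndist_ge0 x y : 0 <= ndist x y. Proof. exact: normr_ge0. Qed.

Let ndist_positivity x y : ndist x y = 0 -> x = y.
Proof. by move=> /normr0_eq0/eqP; rewrite subr_eq0 => /eqP. Qed.

Let ball_ndist (x : B) (e : R) : ball x e = [set y | ndist x y < e].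
Proof.
rewrite -ball_normE; apply/seteqP.
by split=> y; rewrite /ball_ /ndist /= distrC.
Qed.

#[non_forgetful_inheritance]
HB.instance Definition _ := PseudoMetric_isMetric.Build R
  (CompleteNormedModule.sort B) ndist_ge0 ndist_positivity ball_ndist.

End norm_metric.

(* A countable family of balls is a countable set of pairs (center, radius), so
   that finite covers, and the empty one, are included.  The closed balls are
   [mdist _ _ <= r]: the library's [closed_ball] is the closure of the open ball,
   which can be smaller in a general metric space. *)
Definition ball_cover (R : realType) (Z : metricType R) (V : set Z)
    (C : set (Z * R)) : Prop :=
  [/\ countable C,
      forall b, C b -> 0 < b.2 &
      V `<=` \bigcup_(b in C) [set z | mdist b.1 z <= b.2] ].

Definition hausdorff_content (R : realType) (Z : metricType R) (m : R)
    (V : set Z) : \bar R :=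
  ereal_inf [set \esum_(b in C) ((b.2 `^ m)%:E)%E | C in ball_cover V].

(* [f] is a total function of which only the restriction to [Y] matters. *)
Definition continuous_extension (R : realType) (X Z : metricType R)
    (Y : set X) (U : set Z) (f F : X -> Z) : Prop :=
  [/\ continuous F, range F `<=` U & {in Y, F =1 f}].

(* [ereal_inf set0 = +oo], as wanted when there is no extension. *)
Definition filling (R : realType) (X Z : metricType R) (m : R)
    (Y : set X) (U : set Z) (f : X -> Z) : \bar R :=
  ereal_inf [set hausdorff_content m (range F) |
             F in continuous_extension Y U f].

(* Main.v *)
Require Import Defs.
From HB Require Import structures.
From mathcomp Require Import all_boot all_order all_algebra.
From mathcomp Require Import all_classical all_reals all_analysis.
From mathcomp Require Import measurable_realfun.
From mathcomp Require Import ring lra.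
Import Order.TTheory GRing.Theory Num.Theory.
Import numFieldNormedType.Exports.

Local Open Scope classical_set_scope.
Local Open Scope ring_scope.

(** Everything is reduced to a statement about one compact set. A finite
    family of open balls of radii r_i has m-weight [weight m s], the sum of
    the r_i^m. [filling_bound m c] says: whenever a compact set K, contained
    in a bounded open convex set C, is covered by a family of m-weight at
    most V, some continuous map B -> B fixes K pointwise and takes all its
    values in C and in a family of balls of (m+1)-weight at most c
    V^((m+1)/m). Apply it to K = f(Y), with V just above the content of
    f(Y): since f(Y) is compact, f extends to a continuous map X -> B
    ([compact_image_extension], from Tietze's theorem), and composing this
    extension with the map that fixes f(Y) gives a filling of f with the
    required content.

    [filling_bound] is proved by surgery, in the style of Wenger's proof of
    Gromov's isoperimetric inequality of Euclidean type. Three facts carry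
    it.

    Cones are cheap. Moving a ball of radius r along a segment of length T
    sweeps out about T/r balls of radius about r, hence (m+1)-weight about T
    r^m; so a cone of length T over a family of m-weight W costs about T W
    ([cone_over_balls]). This is what one wants as long as T is comparable
    with V^(1/m), but K may be much wider than that.

    Homotopies are free. If f and g are joined over K by straight segments
    that stay in an open set U, and g|K extends to a map with values in U,
    then so does f|K ([extends_into_homotopy]). So K can be replaced by its
    image phi(K) at the price of covering the segments swept out between x
    and phi(x).

    Good spheres exist. Around a point of K covered by a ball of the family,
    there is a scale T such that the balls meeting the ball of radius T
    weigh at least (aT)^m, which is no longer true of lam T
    ([last_dense_scale]). Between T and lam T the weight can only grow by a
    bounded factor, so averaging over the radii gives a sphere that cuts few
    balls: their (m-1)-weight is small compared with T^(m-1) ([thin_cut]).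
    By induction on the dimension the slice of K near that sphere has a
    filling of m-weight at most a quarter of the weight inside the sphere.
    The inside of K is then replaced by this filling; the two are homotopic
    through cones with vertex at the centre, of length about T, which is at
    most a constant times V^(1/m) ([surgery]).

    A surgery destroys weight and its cost is at most a constant times
    V^(1/m) times the weight that it destroys, so any number of surgeries
    costs at most a constant times V^(1/m) V. Surgeries centred in the balls
    of the given family, until none of them is left, halve the weight
    ([remove_old_balls]); after enough halvings the weight is so small that
    a cone over all that remains, however long, costs next to nothing
    ([fill_by_cone]).

    The induction goes from m-1 to m. It starts with 0 < m <= 1, where
    r^(m-1) does not decrease as r shrinks: a sphere for which the
    (m-1)-weight of the cut balls is small enough cuts no ball at all, and
    there is nothing to fill. In the step the choice lam = 1 + 1/(m+1) keeps
    the powers of lam bounded; a constant k^m in dimension m-1 then gives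
    one of order (m+2)^2 k^(m-1) in dimension m, which for k = 100 m is less
    than (100(m+1))^(m+1). *)

(** * Extending maps with compact image *)

Lemma continuous_geometric_limit (R : realType) (X : topologicalType)
    (B : completeNormedModType R) (s : nat -> X -> B) :
  (forall n, continuous (s n)) ->
  (forall n x, `|s n.+1 x - s n x| <= 2^-1 ^+ n) ->
  exists2 F : X -> B, continuous F & forall x, s ^~ x @ \oo --> F x.
Proof.
move=> cs ds.
have dsn n k x : `|s (n + k)%N x - s n x| <= 2 * 2^-1 ^+ n - 2 * 2^-1 ^+ (n + k).
  elim: k => [|k IH]; first by rewrite addn0 !subrr normr0.
  rewrite addnS (le_trans (ler_distD (s (n + k)%N x) _ _))//.
  have := lerD (ds (n + k)%N x) IH; rewrite exprS => /le_trans; apply.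
  by set a := _ ^+ (n + k); lra.
pose h : nat -> arrow_uniform_type X B := s.
have cvgh' : cvg (h @ \oo).
  apply/cauchy_cvgP/cauchy_ballP => eps epos; near_simpl.
  suff : \forall x & x' \near \oo, (x' <= x)%N -> ball (h x) eps (h x').
    move=>/[dup]; rewrite {1}near_swap; apply: filter_app2; near=> n m.
    by have /orP[mn /(_ mn)/ball_sym + _| ? _] := leq_total n m; apply.
  near=> n m; move=> /= MN; rewrite /ball /= /h => t.
  rewrite -ball_normE /ball_ /=.
  rewrite -(subnKC MN) (le_lt_trans (dsn _ _ _))//.
  rewrite (@le_lt_trans _ _ (2 * 2^-1 ^+ m))//.
    by rewrite gerBl mulr_ge0// exprn_ge0// invr_ge0.
  rewrite mulrC -ltr_pdivlMr// -[ltLHS]ger0_norm ?exprn_ge0 ?invr_ge0//.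
  near: m; apply: (cvgr0_norm_lt (fun _ => _ : R^o)).
    by apply: cvg_expr; rewrite ger0_norm ?invr_ge0// invf_lt1// ltr1n.
  by rewrite divr_gt0.
have cvgh : {uniform, h @ \oo --> lim (h @ \oo)}.
  by move=> ?; rewrite /= uniform_nbhsT; exact: cvgh'.
exists (lim (h @ \oo)).
  apply: (@uniform_limit_continuous X B (h @ \oo) (lim (h @ \oo))) => //.
  by near_simpl; apply: nearW.
move=> t.
by have /pointwise_cvgP/(_ t) := [elaborate pointwise_uniform_cvg _ cvgh].
Unshelve. all: by end_near. Qed.

(** The radial retraction onto the closed ball of radius c about the origin. *)
Definition norm_clamp {R : realType} {B : normedModType R} (c : R) (v : B) : B :=
  (c / Num.max c `|v|) *: v.

Lemma norm_clamp_le (R : realType) (B : normedModType R) (c : R) (v : B) :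
  0 < c -> `|norm_clamp c v| <= c.
Proof.
move=> c0; rewrite normrZ.
have m0 : 0 < Num.max c `|v| by rewrite lt_max c0.
have cm0 : 0 <= c / Num.max c `|v| by rewrite divr_ge0// ltW.
by rewrite (ger0_norm cm0) mulrAC ler_pdivrMr// ler_pM2l// le_max lexx orbT.
Qed.

Lemma norm_clamp_id (R : realType) (B : normedModType R) (c : R) (v : B) :
  0 < c -> `|v| <= c -> norm_clamp c v = v.
Proof.
by move=> c0 vc; rewrite /norm_clamp max_l// divff ?gt_eqF// scale1r.
Qed.

Lemma cvg_maxr (R : realType) (T : Type) (F : set_system T) {FF : Filter F}
    (f g : T -> R) (a b : R) :
  f @ F --> a -> g @ F --> b -> (fun x => Num.max (f x) (g x)) @ F --> Num.max a b.
Proof.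
move=> fa gb; rewrite maxr_absE.
under eq_fun do rewrite maxr_absE.
by apply: cvgMr_tmp; apply: cvgD; [apply: cvgD | apply: cvg_norm; apply: cvgB].
Qed.

Lemma norm_clamp_continuous (R : realType) (B : normedModType R) (c : R) :
  0 < c -> continuous (@norm_clamp R B c).
Proof.
move=> c0 v; apply: cvgZ; last exact: cvg_id.
apply: cvgM; first exact: cvg_cst.
apply: cvgV; first by rewrite gt_eqF// lt_max c0.
apply: cvg_maxr; first exact: cvg_cst.
by apply: cvg_norm; exact: cvg_id.
Qed.

Lemma compact_finite_net (R : realType) (B : normedModType R) (K : set B) (e : R) :
  compact K -> 0 < e ->
  exists s : seq B, forall z, K z -> exists2 x, x \in s & `|z - x| < e.
Proof.
move=> cK e0; move: cK; rewrite compact_cover => /(_ B setT (fun x => ball x e)).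
case=> [x _||D _ KD]; first exact: ball_open.
  by move=> z _; exists z => //; exact: ballxx.
exists (finmap.enum_fset D) => z /KD [x xD]; rewrite -ball_normE /ball_ /= => zx.
by exists x; rewrite // distrC.
Qed.

(** The tent functions of a finite e/2-net of K sum to at least e/2 on K.
    Dividing by the maximum of that sum and e/2, rather than by the sum,
    makes the quotients continuous on the whole space. *)
Lemma partition_of_unity (R : realType) (B : normedModType R) (K : set B) (e : R) :
  compact K -> 0 < e ->
  exists (s : seq B) (h : B -> B -> R), [/\ forall x, continuous (h x),
    forall x z, 0 <= h x z <= 1,
    forall x z, h x z != 0 -> `|z - x| <= e &
    forall z, K z -> \sum_(x <- s) h x z = 1].
Proof.
move=> cK e0.
have e20 : 0 < e / 2 by rewrite divr_gt0.
have [s sK] := @compact_finite_net R B K (e / 2) cK e20.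
pose phi (x z : B) : R := Num.max 0 (e - `|z - x|).
pose S (z : B) := \sum_(x <- s) phi x z.
pose h (x z : B) : R := if x \in s then phi x z / Num.max (S z) (e / 2) else 0.
have phi0 x z : 0 <= phi x z by rewrite le_max lexx.
have cphi x : continuous (phi x).
  move=> z; apply: cvg_maxr; first exact: cvg_cst.
  apply: cvgB; first exact: cvg_cst.
  by apply: cvg_norm; apply: cvgB; [exact: cvg_id | exact: cvg_cst].
have m0 z : 0 < Num.max (S z) (e / 2) by rewrite lt_max divr_gt0// orbT.
have phiS x z : x \in s -> phi x z <= S z.
  move=> xs; rewrite /S (perm_big _ (perm_to_rem xs)) big_cons lerDl.
  by apply: sumr_ge0.
exists s, h; split.
- rewrite /h => x; case: (x \in s) => z; last exact: cvg_cst.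
  apply: cvgM; first exact: cphi.
  apply: cvgV; first by rewrite gt_eqF.
  apply: cvg_maxr; last exact: cvg_cst.
  apply: (@cvg_big R B +%R 0 xpredT _ B (nbhs z) s phi) => //.
    exact: add_continuous.
  by move=> i _; exact: cphi.
- move=> x z; rewrite /h; case: ifP => xs; last by rewrite lexx ler01.
  rewrite divr_ge0 ?(ltW (m0 z))//= ler_pdivrMr// mul1r.
  by rewrite le_max phiS.
- move=> x z; rewrite /h; case: ifP => _; last by rewrite eqxx.
  rewrite mulf_eq0 negb_or => /andP[+ _].
  by rewrite /phi leNgt; apply: contraNN => zx; rewrite max_l// subr_le0 ltW.
- move=> z /sK[x xs zx].
  have Se : e / 2 <= S z.
    apply: le_trans (phiS _ z xs).
    by rewrite /phi le_max; apply/orP; right; lra.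
  rewrite big_seq (eq_bigr (fun x => phi x z / S z)); last first.
    by move=> y ys; rewrite /h ys max_l.
  rewrite -big_seq -mulr_suml divff// gt_eqF//.
  by apply: lt_le_trans Se; rewrite divr_gt0.
Qed.

(** Up to e, f is a combination of finitely many fixed vectors whose
    coefficients are bounded real functions on Y, and Tietze's theorem
    extends those. *)
Lemma approximate_extension (R : realType) (B : normedModType R)
    (X : pseudoMetricType R) (Y : set X) (f : X -> B) (e : R) :
  closed Y -> {within Y, continuous f} -> compact (f @` Y) -> 0 < e ->
  exists2 E : X -> B, continuous E & forall y, Y y -> `|E y - f y| <= e.
Proof.
move=> cY cf cfY e0.
have [s [h [ch h01 hsupp hsum]]] := @partition_of_unity R B _ e cfY e0.
have tietze x : exists g : X -> R, continuous g /\ forall y, Y y -> g y = h x (f y).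
  have [] := @continuous_bounded_extension X R (@pseudometric_normal R X) Y cY
    (fun y => h x (f y)) 1 ltr01.
  - by move=> y; apply: continuous_comp; [exact: cf | exact: ch].
  - move=> y _; have /andP[h0 h1] := h01 x (f y).
    by rewrite ger0_norm.
  move=> g [fg cg _]; exists g; split => // y Yy; rewrite fg//.
  exact/mem_set.
have [g gP] := choice tietze.
exists (fun y => \sum_(x <- s) g x y *: x).
  move=> y; apply: (@cvg_big B B +%R 0 xpredT _ X (nbhs y) s
    (fun x y => g x y *: x)) => //.
    exact: add_continuous.
  by move=> x _; apply: cvgZr_tmp; exact: (gP x).1.
move=> y Yy.
have fyK : (f @` Y) (f y) by exists y.
rewrite -[f y]scale1r -(hsum _ fyK) scaler_suml -sumrB.
apply: le_trans (ler_norm_sum _ _ _) _.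
rewrite -[leRHS]mul1r -(hsum _ fyK) mulr_suml; apply: ler_sum => x _.
rewrite (gP x).2// -scalerBr normrZ distrC.
have /andP[h0 _] := h01 x (f y); rewrite ger0_norm//.
have [->|hn] := eqVneq (h x (f y)) 0; first by rewrite !mul0r.
by rewrite ler_wpM2l// hsupp.
Qed.

(** Extend f approximately with errors 2^-(n+1) and sum the successive
    differences of these extensions; clamping the differences in norm
    changes nothing on Y and makes the series converge uniformly off Y. *)
Lemma compact_image_extension (R : realType) (B : completeNormedModType R)
    (X : pseudoMetricType R) (Y : set X) (f : X -> B) :
  closed Y -> {within Y, continuous f} -> compact (f @` Y) ->
  exists2 F : X -> B, continuous F & forall y, Y y -> F y = f y.
Proof.
move=> cY cf cfY.
pose e n : R := 2^-1 ^+ n / 2.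
have e0 n : 0 < e n by rewrite divr_gt0// exprn_gt0// invr_gt0.
have /choice[E EP] : forall n, exists g : X -> B,
    continuous g /\ forall y, Y y -> `|g y - f y| <= e n.
  move=> n.
  by have [E cE EP] := approximate_extension R B X Y f (e n) cY cf cfY (e0 n); exists E.
pose s n x := E 0%N x + \sum_(0 <= k < n) norm_clamp (2 * e k) (E k.+1 x - E k x).
have e20 n : 0 < 2 * e n by rewrite mulr_gt0.
have [] := continuous_geometric_limit R X B s.
- elim=> [|n IH] x.
    rewrite (_ : s 0%N = E 0%N); first exact: (EP 0%N).1.
    by apply/funext => z; rewrite /s big_nil addr0.
  rewrite (_ : s n.+1 = fun x => s n x + norm_clamp (2 * e n) (E n.+1 x - E n x)).
    apply: cvgD; first exact: IH.
    apply: (@continuous_comp _ _ _ (fun x => E n.+1 x - E n x)).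
      by apply: cvgB; exact: (EP _).1.
    exact: norm_clamp_continuous.
  by apply/funext => z; rewrite /s big_nat_recr//= addrA.
- move=> n x; rewrite /s big_nat_recr//= addrA.
  rewrite [X in `|X|]addrC addKr.
  by apply: le_trans (@norm_clamp_le _ _ _ _ (e20 n)) _; rewrite /e mulrC divfK.
move=> F cF sF; exists F => // y Yy.
have sE n : s n y = E n y.
  elim: n => [|n IH]; first by rewrite /s big_nil addr0.
  rewrite /s big_nat_recr//= addrA -/(s n y) IH norm_clamp_id//.
    by rewrite addrC subrK.
  rewrite (le_trans (ler_distD (f y) _ _))// (distrC (f y)).
  have := (EP n).2 y Yy; have := (EP n.+1).2 y Yy.
  by have := e0 n; rewrite /e exprS; set a := 2^-1 ^+ n; lra.
have Ef : s ^~ y @ \oo --> f y.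
  apply/cvgrPdist_le => eps eps0.
  have g0 : geometric 1 (2^-1 : R) @ \oo --> 0.
    by apply: cvg_geometric; rewrite ger0_norm ?invr_ge0// invf_lt1// ltr1n.
  near=> n; rewrite sE distrC (le_trans ((EP n).2 y Yy))//.
  apply: (@le_trans _ _ `|geometric 1 (2^-1 : R) n|).
    rewrite /geometric /= mul1r ger0_norm ?exprn_ge0 ?invr_ge0//.
    by rewrite /e ler_pdivrMr// ler_peMr ?exprn_ge0 ?invr_ge0// ler1n.
  by near: n; exact: (cvgr0_norm_le (fun _ => _ : R^o) g0).
exact: (@cvg_unique _ (@norm_hausdorff _ B) _ _ _ _ (sF y) Ef).
Unshelve. all: by end_near. Qed.

(** * Homotopies along segments *)

(** The tube lemma along the unit interval of the homotopy parameter. *)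
Lemma open_segments (R : realType) (T : topologicalType) (B : normedModType R)
    (f g : T -> B) (U : set B) :
  continuous f -> continuous g -> open U ->
  open [set x | forall t : R, 0 <= t <= 1 -> U (f x + t *: (g x - f x))].
Proof.
move=> cf cg oU; rewrite openE => x Ux.
have := (compact_near_coveringP _).1 (@segment_compact R 0 1).
move=> /(_ T (nbhs x) (fun y t => U (f y + t *: (g y - f y)))).
have H : forall t : R, `[0, 1]%classic t ->
    \forall t' \near t & y \near nbhs x, U (f y + t' *: (g y - f y)).
  move=> t; rewrite /= in_itv /= => t01.
  have cF : {for (t, x), continuous
      (fun z : R * T => f z.2 + z.1 *: (g z.2 - f z.2))}.
    apply: continuousD.
      by apply: (@continuous_comp _ _ _ snd f); [exact: cvg_snd | exact: cf].
    apply: continuousZ; first exact: cvg_fst.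
    apply: continuousB.
      by apply: (@continuous_comp _ _ _ snd g); [exact: cvg_snd | exact: cg].
    by apply: (@continuous_comp _ _ _ snd f); [exact: cvg_snd | exact: cf].
  have := cF U; rewrite /= => /(_ _); apply.
  by apply: open_nbhs_nbhs; split => //; exact: Ux.
move=> /(_ _ H); apply: filterS => y Hy t t01.
by apply: Hy; rewrite /= in_itv.
Qed.

Lemma urysohn_normed (R : realType) (B : normedModType R) (K O : set B) :
  closed K -> open O -> K `<=` O ->
  exists u : B -> R, [/\ continuous u, forall x, 0 <= u x <= 1,
    forall x, K x -> u x = 0 & forall x, ~ O x -> u x = 1].
Proof.
move=> cK oO KO.
have /normal_separatorP H := @pseudometric_normal R B.
have cO : closed (~` O) by rewrite closedC.
have KO0 : K `&` ~` O = set0.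
  by apply/seteqP; split => // x [/KO].
have /(@uniform_separatorP _ R)[u [cu u01 u0 u1]] := H R _ _ cK cO KO0.
exists u; split=> //.
- by move=> x; have := u01 (u x); rewrite /= in_itv /=; apply; exists x.
- by move=> x Kx; apply: u0; exists x.
- by move=> x Ox; apply: u1; exists x.
Qed.

(** The values of f off K are irrelevant; only the restriction of f to K has
    to extend. *)
Definition extends_into {R : realType} {B : normedModType R}
    (K : set B) (f : B -> B) (U : set B) :=
  exists F : B -> B, [/\ continuous F, forall x, U (F x) &
    forall x, K x -> F x = f x].

(** Borsuk's homotopy extension argument. Let G extend g|K. The straight
    homotopy from f to G stays in U over a neighbourhood of K, and a Urysohn
    function u follows it to its end before leaving that neighbourhood. *)
Lemma extends_into_homotopy (R : realType) (B : normedModType R)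
    (K U : set B) (f g : B -> B) :
  closed K -> open U -> continuous f ->
  (forall x t, K x -> 0 <= t <= 1 -> U (f x + t *: (g x - f x))) ->
  extends_into K g U -> extends_into K f U.
Proof.
move=> cK oU cf fgU [G [cG GU Gg]].
pose O := [set x | forall t : R, 0 <= t <= 1 -> U (f x + t *: (G x - f x))].
have oO : open O by exact: open_segments.
have KO : K `<=` O by move=> x Kx t t01; rewrite Gg //; exact: fgU.
have [u [cu u01 u0 u1]] := urysohn_normed R B K O cK oO KO.
exists (fun x => f x + u x *: (G x - f x)); split.
- move=> x; apply: cvgD; first exact: cf.
  by apply: cvgZ; [exact: cu | apply: cvgB; [exact: cG | exact: cf]].
- move=> x; have [Ox|Ox] := pselect (O x); first exact: Ox.
  by rewrite u1 // scale1r addrC subrK.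
- by move=> x Kx; rewrite u0 // scale0r addr0.
Qed.

(** * Families of balls and cones over them *)

Lemma gt0_powRD (R : realType) (x a b : R) :
  0 < x -> x `^ (a + b) = x `^ a * x `^ b.
Proof. by move=> x0; rewrite powRD// (gt_eqF x0) implybT. Qed.

Lemma powR_ltr (R : realType) (x y m : R) :
  0 < m -> 0 <= x -> 0 <= y -> (x `^ m < y `^ m) = (x < y).
Proof.
move=> m0 x0 y0; apply/idP/idP => [|xy]; last by rewrite gt0_ltr_powR.
by apply: contraTT; rewrite -!leNgt => yx; rewrite ge0_ler_powR// ltW.
Qed.

Lemma powR_ler (R : realType) (x y m : R) :
  0 < m -> 0 <= x -> 0 <= y -> (x `^ m <= y `^ m) = (x <= y).
Proof. by move=> m0 x0 y0; rewrite leNgt powR_ltr// -leNgt. Qed.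

Section ball_families.
Context {R : realType} {B : normedModType R}.
Implicit Types (s : seq (B * R)) (m : R) (b : B * R).

Definition balls_union s : set B :=
  [set z | exists2 b, b \in s & `|z - b.1| < b.2].

Definition weight m s : R := \sum_(b <- s) b.2 `^ m.

Definition pos_radii s := forall b, b \in s -> 0 < b.2.

Lemma open_balls_union s : open (balls_union s).
Proof.
rewrite openE => z [b bs zb].
apply: (@filterS _ _ _ (ball b.1 b.2)).
  by move=> y; rewrite -ball_normE /ball_ /= distrC => yb; exists b.
apply: open_nbhs_nbhs; split; first exact: ball_open.
by rewrite -ball_normE /ball_ /= distrC.
Qed.

Lemma balls_union_cat s1 s2 :
  balls_union (s1 ++ s2) = balls_union s1 `|` balls_union s2.
Proof.
apply/seteqP; split=> z.
  by case=> b; rewrite mem_cat => /orP[bs|bs] zb; [left|right]; exists b.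
by case=> -[b bs zb]; exists b => //; rewrite mem_cat bs ?orbT.
Qed.

Lemma weight_cat m s1 s2 : weight m (s1 ++ s2) = weight m s1 + weight m s2.
Proof. by rewrite /weight big_cat. Qed.

Lemma weight_ge0 m s : 0 <= weight m s.
Proof. by apply: sumr_ge0 => b _; exact: powR_ge0. Qed.

Lemma weight_perm m s1 s2 : perm_eq s1 s2 -> weight m s1 = weight m s2.
Proof. by move=> p; rewrite /weight (perm_big _ p). Qed.

Lemma weight_filterC m (P : pred (B * R)) s :
  weight m s = weight m [seq b <- s | P b] + weight m [seq b <- s | ~~ P b].
Proof. by rewrite -weight_cat; apply: weight_perm; rewrite perm_sym (permEl (perm_filterC P s)). Qed.

Lemma le_weight_mem m s b : b \in s -> b.2 `^ m <= weight m s.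
Proof.
move=> bs; rewrite /weight (perm_big _ (perm_to_rem bs)) big_cons lerDl.
by apply: sumr_ge0 => ? _; exact: powR_ge0.
Qed.

Lemma le_weight_filter m (P Q : pred (B * R)) s :
  (forall b, P b -> Q b) -> weight m [seq b <- s | P b] <= weight m [seq b <- s | Q b].
Proof.
move=> PQ; rewrite /weight !big_filter [leRHS](bigID P)/=.
have QP : (fun b => Q b && P b) =1 P.
  by move=> b; rewrite andbC; have := PQ b; case: (P b) => //= ->.
by rewrite (eq_bigl _ _ QP) lerDl; apply: sumr_ge0 => b _; exact: powR_ge0.
Qed.

Lemma pos_radii_cat s1 s2 :
  pos_radii s1 -> pos_radii s2 -> pos_radii (s1 ++ s2).
Proof. by move=> p1 p2 b; rewrite mem_cat => /orP[/p1|/p2]. Qed.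

Lemma pos_radii_filter P s : pos_radii s -> pos_radii [seq b <- s | P b].
Proof. by move=> ps b; rewrite mem_filter => /andP[_ /ps]. Qed.

(** The cone is covered by N balls of radius lam r centred on the axis, with
    N about T / ((lam - 1) r): the excess (lam - 1) r of the radius bridges
    the gap between consecutive centres. *)
Lemma cone_over_ball (c p : B) (r T lam m : R) :
  0 < r -> r <= T -> 1 < lam ->
  exists h : seq (B * R), [/\ pos_radii h,
    weight (m + 1) h <= lam `^ (m + 1) * (T * (lam / (lam - 1))) * r `^ m &
    forall x (t : R), `|x - c| < r -> `|x - p| <= T -> 0 <= t <= 1 ->
      balls_union h (p + t *: (x - p))].
Proof.
move=> r0 rT lam1; have T0 : 0 < T by apply: lt_le_trans rT.
have l0 : 0 < lam - 1 by lra.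
pose q := T / ((lam - 1) * r).
have q0 : 0 <= q by rewrite divr_ge0 ?mulr_ge0// ltW.
pose N := (Num.truncn q).+1.
have /andP[qN1 qN2] := truncn_itv q0.
have N0 : 0 < N%:R :> R by rewrite ltr0n.
exists [seq (p + (k.+1%:R / N%:R) *: (c - p), lam * r) | k <- iota 0 N]; split.
- by move=> b /mapP[k _ ->] /=; rewrite mulr_gt0//; lra.
- rewrite /weight big_map.
  rewrite (eq_bigr (fun=> (lam * r) `^ (m + 1)))//.
  rewrite big_const_seq count_predT size_iota iter_addr_0.
  rewrite powRM ?(ltW r0)//; last lra.
  rewrite (@gt0_powRD _ r)// powRr1 ?(ltW r0)// -mulr_natl.
  have NT : N%:R * r <= T * (lam / (lam - 1)).
    have -> : T * (lam / (lam - 1)) = (q + T / r) * r.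
      by rewrite /q; field; rewrite ?gt_eqF//; lra.
    rewrite ler_pM2r// /N -natr1 lerD// ler_pdivlMr// mul1r//.
  rewrite [leLHS](_ : _ = lam `^ (m + 1) * (N%:R * r) * r `^ m); last by ring.
  by rewrite ler_wpM2r ?powR_ge0// ler_wpM2l// powR_ge0.
- move=> x t xc xp /andP[t0 t1].
  have [k kN tk] : exists2 k, (k < N)%N & `|t - k.+1%:R / N%:R| <= N%:R^-1.
    have [t1'|t1'] := ltP t 1; last first.
      exists N.-1; first by rewrite prednK.
      rewrite prednK// divff ?gt_eqF//.
      have -> : t = 1 by apply/eqP; rewrite eq_le t1.
      by rewrite subrr normr0 invr_ge0 ltW.
    have tN0 : 0 <= t * N%:R by rewrite mulr_ge0// ltW.
    have /andP[k1 k2] := truncn_itv tN0.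
    exists (Num.truncn (t * N%:R)).
      rewrite -(ltr_nat R); apply: le_lt_trans k1 _.
      by rewrite -[ltRHS]mul1r ltr_pM2r.
    rewrite distrC ger0_norm; last by rewrite subr_ge0 ler_pdivlMr// ltW.
    by rewrite lerBlDr -natr1 mulrDl mul1r addrC lerD2l ler_pdivrMr.
  exists (p + (k.+1%:R / N%:R) *: (c - p), lam * r).
    by apply/mapP; exists k => //; rewrite mem_iota.
  rewrite /= opprD addrA [p + _]addrC addrK.
  set u : R := _ / _ in tk *.
  have u0 : 0 < u by rewrite divr_gt0.
  have u1 : u <= 1 by rewrite ler_pdivrMr// mul1r ler_nat.
  have -> : t *: (x - p) - u *: (c - p) = (t - u) *: (x - p) + u *: (x - c).
    have -> : x - c = (x - p) - (c - p) by rewrite opprB subrKA.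
    by move: (x - p) (c - p) => X C; rewrite scalerBl scalerBr addrA subrK.
  have NT : N%:R^-1 * T <= (lam - 1) * r.
    rewrite mulrC ler_pdivrMr// mulrC -ler_pdivrMr ?mulr_gt0//.
    exact: ltW.
  apply: le_lt_trans (ler_normD _ _) _. rewrite normrZ [X in _ + X]normrZ (gtr0_norm u0).
  have A : `|t - u| * `|x - p| <= (lam - 1) * r.
    apply: le_trans NT; apply: ler_pM => //.
  have C : u * `|x - c| < r.
    apply: le_lt_trans xc; rewrite -[leRHS]mul1r ler_wpM2r//.
  lra.
Qed.

Lemma cone_over_balls (s : seq (B * R)) (p : B) (T lam m : R) :
  pos_radii s -> (forall b, b \in s -> b.2 <= T) -> 1 < lam ->
  exists h : seq (B * R), [/\ pos_radii h,
    weight (m + 1) h <= lam `^ (m + 1) * (T * (lam / (lam - 1))) * weight m s &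
    forall x (t : R), balls_union s x -> `|x - p| <= T -> 0 <= t <= 1 ->
      balls_union h (p + t *: (x - p))].
Proof.
move=> + + lam1; elim: s => [|b s IH] ps sT.
  exists [::]; split=> //; first by rewrite /weight !big_nil mulr0.
  by move=> x t [].
have [b' b's|b' b's|h [ph wh ch]] := IH.
- by apply: ps; rewrite in_cons b's orbT.
- by apply: sT; rewrite in_cons b's orbT.
have [||h1 [ph1 wh1 ch1]] := cone_over_ball b.1 p b.2 T lam m _ _ lam1.
- by apply: ps; rewrite mem_head.
- by apply: sT; rewrite mem_head.
exists (h1 ++ h); split; first exact: pos_radii_cat.
  by rewrite weight_cat [weight m _]/weight big_cons mulrDr lerD.
move=> x t [b']; rewrite in_cons => /orP[/eqP->|b's] xb' xT t01.
  by rewrite balls_union_cat; left; exact: ch1.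
by rewrite balls_union_cat; right; apply: ch => //; exists b'.
Qed.

End ball_families.

(** * Surgery along a sphere *)

(** If every point of [a, b[ carried more than M, integrating over [a, b[
    would give at least M (b - a). *)
Lemma interval_pigeonhole (R : realType) (I : eqType) (s : seq I)
    (w l u : I -> R) (a b M : R) :
  a < b -> (forall i, 0 <= w i) -> (forall i, i \in s -> l i <= u i) ->
  \sum_(i <- s) w i * (u i - l i) < M * (b - a) ->
  exists2 x : R, a <= x < b & \sum_(i <- s | l i < x < u i) w i <= M.
Proof.
move=> ab w0 lu sM; apply: contrapT => H.
pose D : set R := `[a, b[%classic.
pose mu := @lebesgue_measure R.
have mD : measurable D by exact: measurable_itv.
pose f i (x : R) : \bar R := ((w i)%:E * (\1_(`]l i, u i[%classic : set R) x)%:E)%E.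
have f0 i x : (0 <= f i x)%E by rewrite mule_ge0// lee_fin.
have mI i : measurable (`]l i, u i[%classic : set R) by exact: measurable_itv.
have mind i : measurable_fun D (fun x => (\1_(`]l i, u i[%classic : set R) x)%:E).
  by apply/measurable_EFinP; apply: measurable_indic; exact: mI.
have mf i : measurable_fun D (f i) by apply: measurable_funeM; exact: mind.
have fE x : (\sum_(i <- s) f i x)%E = (\sum_(i <- s | l i < x < u i) w i)%:E.
  rewrite [in RHS]big_mkcond -sumEFin; apply: eq_bigr => i _.
  rewrite /f indicE mem_setE in_itv /=; case: ifP => _; first by rewrite mule1.
  by rewrite mule0.
have muD : mu D = (b - a)%:E by rewrite /mu lebesgue_measure_itv/= lte_fin ab.
have : (M%:E * (b - a)%:E <= \sum_(i <- s) (w i * (u i - l i))%:E)%E.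
  have [M0|M0] := leP 0 M; last first.
    apply: (@le_trans _ _ 0%E).
      by rewrite -EFinM lee_fin nmulr_rle0 ?subr_ge0 ?ltW.
    rewrite sumEFin lee_fin big_seq; apply: sumr_ge0 => i /lu lui.
    by rewrite mulr_ge0// subr_ge0.
  rewrite -muD -(integral_cst mu mD).
  apply: (@le_trans _ _ (\int[mu]_(x in D) (\sum_(i <- s) f i x))%E).
    apply: ge0_le_integral => //.
    - by apply: emeasurable_sum; exact: mf.
    - move=> x Dx; rewrite fE lee_fin leNgt; apply/negP => xM; apply: H.
      exists x; last exact: ltW.
      by move: Dx; rewrite /D /= in_itv.
  rewrite ge0_integral_sum// big_seq [leRHS]big_seq; apply: lee_sum => i si.
  rewrite ge0_integralZl_EFin//; last exact: mind.
  rewrite EFinM; apply: lee_wpmul2l; first by rewrite lee_fin.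
  rewrite integral_indic//.
  apply: (@le_trans _ _ (mu (`]l i, u i[%classic))).
    apply: (@le_measure _ _ _ (@lebesgue_measure R)); rewrite ?inE.
    - by apply: measurableI; [exact: mI | exact: mD].
    - exact: mI.
    - exact: subIsetl.
  rewrite /mu lebesgue_measure_itv/=; case: ifP => // _.
  by rewrite lee_fin subr_ge0 lu.
by rewrite sumEFin -EFinM lee_fin leNgt sM.
Qed.

(** The powers (lam^n T)^m are unbounded while v is bounded, so the lower
    bound on v must fail along the scales lam^n T for the first time. *)
Lemma last_dense_scale (R : realType) (v : R -> R) (m lam T V : R) :
  0 < m -> 1 < lam -> 0 < T -> (forall t, v t <= V) -> T `^ m <= v T ->
  exists T0, [/\ T <= T0, T0 `^ m <= v T0 & v (lam * T0) < (lam * T0) `^ m].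
Proof.
move=> m0 lam1 T0 vV TT; apply: contrapT => H.
have lam0 : 0 < lam by lra.
have all n : (T * lam ^+ n) `^ m <= v (T * lam ^+ n).
  elim: n => [|n IH]; first by rewrite expr0 mulr1.
  rewrite leNgt; apply/negP => lt; apply: H; exists (T * lam ^+ n); split => //.
    by rewrite ler_peMr ?(ltW T0)// exprn_ege1// ltW.
  by rewrite mulrCA -exprS.
have V0 : 0 <= V by apply: le_trans (vV T); apply: le_trans TT; exact: powR_ge0.
have bern n : 1 + n%:R * (lam - 1) <= lam ^+ n.
  elim: n => [|n IH]; first by rewrite mul0r addr0 expr0.
  rewrite exprS -natr1.
  have : lam * (1 + n%:R * (lam - 1)) <= lam * lam ^+ n by rewrite ler_pM2l.
  have : 0 <= n%:R * (lam - 1) * (lam - 1) by rewrite !mulr_ge0// subr_ge0 ltW.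
  by set k : R := n%:R; set z := lam ^+ n; lra.
(* By [bern], lam^n exceeds V^(1/m) / T as soon as n exceeds q. *)
pose q := V `^ m^-1 / T / (lam - 1).
have q0 : 0 <= q by rewrite !divr_ge0 ?powR_ge0 ?subr_ge0 ?(ltW T0) ?(ltW lam1).
have /andP[_ qN] := truncn_itv q0.
set N := (Num.truncn q).+1 in qN.
have : T * lam ^+ N <= V `^ m^-1.
  rewrite -(powR_ler _ _ _ m) ?powR_ge0//; last first.
    by rewrite mulr_ge0 ?exprn_ge0// ltW.
  rewrite -powRrM mulVf ?gt_eqF// powRr1//.
  exact: le_trans (all N) (vV _).
apply/negP; rewrite -ltNge -ltr_pdivrMl// mulrC.
apply: lt_le_trans (bern N).
have -> : V `^ m^-1 / T = q * (lam - 1) by rewrite /q divfK// gt_eqF// subr_gt0.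
have : q * (lam - 1) < N%:R * (lam - 1) by rewrite ltr_pM2r// subr_gt0.
lra.
Qed.

Lemma cvg_minr (R : realType) (T : Type) (F : set_system T) {FF : Filter F}
    (f g : T -> R) (a b : R) :
  f @ F --> a -> g @ F --> b -> (fun x => Num.min (f x) (g x)) @ F --> Num.min a b.
Proof.
move=> fa gb; rewrite minr_absE.
under eq_fun do rewrite minr_absE.
by apply: cvgMr_tmp; apply: cvgB; [apply: cvgD | apply: cvg_norm; apply: cvgB].
Qed.

Section surgery.
Context {R : realType} {B : completeNormedModType R}.
Implicit Types (C K Z : set B) (p q x : B) (s n h l : seq (B * R)) (m : R).

(** The bound D and the centre p only serve to control the length of cones
    with vertex p. *)
Definition convex_nbhd C p (D : R) :=
  [/\ open C,
      forall x y (t : R), C x -> C y -> 0 <= t <= 1 -> C (x + t *: (y - x)),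
      C p & forall x, C x -> `|x - p| <= D].

Definition fillable C K s := extends_into K id (C `&` balls_union s).

Lemma convex_nbhd_ball C p (T : R) :
  open C ->
  (forall x y (t : R), C x -> C y -> 0 <= t <= 1 -> C (x + t *: (y - x))) ->
  C p -> 0 < T -> convex_nbhd (C `&` ball p T) p T.
Proof.
move=> oC cC Cp T0; split.
- by apply: openI => //; exact: ball_open.
- move=> x y t [Cx px] [Cy py] /andP[t0 t1]; split; first by apply: cC; rewrite ?t0.
  move: px py; rewrite -ball_normE /ball_ /= => px py.
  have -> : p - (x + t *: (y - x)) = (1 - t) *: (p - x) + t *: (p - y).
    have -> : y - x = (p - x) - (p - y) by rewrite opprB [RHS]addrC subrKA.
    rewrite opprD addrA; move: (p - x) (p - y) => X Y.
    by rewrite scalerBl scale1r scalerBr opprB -!addrA; congr (_ + _); rewrite addrC.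
  apply: le_lt_trans (ler_normD _ _) _; rewrite normrZ [X in _ + X]normrZ.
  have t'0 : 0 <= 1 - t by rewrite subr_ge0.
  rewrite (ger0_norm t'0) (ger0_norm t0).
  have [->|tn0] := eqVneq t 0; first by rewrite subr0 mul1r mul0r addr0.
  have tp : 0 < t by rewrite lt_def tn0.
  have A : t * `|p - y| < t * T by rewrite ltr_pM2l.
  have A' : (1 - t) * `|p - x| <= (1 - t) * T by rewrite ler_wpM2l// ltW.
  lra.
- by split => //; exact: ballxx.
- by move=> x [_]; rewrite -ball_normE /ball_ /= distrC => /ltW.
Qed.

(** A cutoff equal to 1 on the ball of radius rho - e about p and to 0 off
    the ball of radius rho. *)
Definition bump p (rho e : R) x : R :=
  Num.min 1 (Num.max 0 ((rho - `|x - p|) / e)).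

Lemma bump_continuous p (rho e : R) : continuous (bump p rho e).
Proof.
move=> x; apply: cvg_minr; first exact: cvg_cst.
apply: cvg_maxr; first exact: cvg_cst.
apply: cvgMr_tmp; apply: cvgB; first exact: cvg_cst.
by apply: cvg_norm; apply: cvgB; [exact: cvg_id | exact: cvg_cst].
Qed.

Lemma bump01 p (rho e : R) x : 0 <= bump p rho e x <= 1.
Proof. by rewrite /bump le_min ler01 le_max lexx ge_min lexx. Qed.

Lemma bump_out p (rho e : R) x : 0 < e -> rho <= `|x - p| -> bump p rho e x = 0.
Proof.
move=> e0 xp; rewrite /bump max_l ?min_r ?ler01//.
by rewrite ler_pdivrMr// mul0r subr_le0.
Qed.

Lemma bump_in p (rho e : R) x : 0 < e -> `|x - p| <= rho - e -> bump p rho e x = 1.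
Proof.
move=> e0 xp; rewrite /bump min_l// le_max; apply/orP; right.
by rewrite ler_pdivlMr// mul1r lerBrDl -lerBrDr.
Qed.

(** K' keeps the part of K outside the sphere of radius rho and replaces the
    part inside by its image under the map Phi that fills the slice of K by
    the collar rho - e <= |x - p| <= rho. Filling a collar and not just the
    sphere lets the cutoff chi interpolate between Phi and the identity on a
    set where they agree on K, so phi is continuous everywhere and is
    exactly Phi inside and the identity outside. The two maps are not joined
    by one straight homotopy: the segments between x and Phi x would be too
    expensive. Both are instead contracted towards p by chi, and the
    contracted maps agree on K; only cones with vertex p are swept out. *)
Lemma replace_inside C K p q (D rho e T : R) (inner n rest h : seq (B * R)) :
  convex_nbhd C q D -> compact K -> K `<=` C -> C p -> 0 < e -> rho < T ->
  (forall x, K x -> `|x - p| <= rho -> balls_union inner x) ->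
  (forall x, K x -> rho - e <= `|x - p| -> balls_union rest x) ->
  fillable (C `&` ball p T) (K `&` [set x | rho - e <= `|x - p| <= rho]) n ->
  (forall x (t : R), balls_union (inner ++ n) x -> `|x - p| <= T ->
     0 <= t <= 1 -> balls_union h (p + t *: (x - p))) ->
  exists K', [/\ compact K', K' `<=` C, K' `<=` balls_union (rest ++ n) &
    forall l, fillable C K' l -> fillable C K (h ++ l)].
Proof.
move=> [oC cC _ _] cK KC Cp e0 rhoT Kin Krest [Phi [cPhi PhiU Phiid]] hcone.
have clK : closed K by apply: compact_closed => //; exact: norm_hausdorff.
pose chi := bump p rho e.
have cchi : continuous chi by exact: bump_continuous.
pose phi x := x + chi x *: (Phi x - x).
pose phi1 x := x + chi x *: (p - x).
have cphi : continuous phi.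
  move=> x; apply: cvgD; first exact: cvg_id.
  by apply: cvgZ; [exact: cchi | apply: cvgB; [exact: cPhi | exact: cvg_id]].
have cphi1 : continuous phi1.
  move=> x; apply: cvgD; first exact: cvg_id.
  by apply: cvgZ; [exact: cchi | apply: cvgB; [exact: cvg_cst | exact: cvg_id]].
have phi_out x : K x -> rho - e <= `|x - p| -> phi x = x.
  move=> Kx x1; rewrite /phi; have [x2|/ltW x2] := leP `|x - p| rho.
    by rewrite Phiid ?subrr ?scaler0 ?addr0//; split => //=; rewrite x1.
  by rewrite /chi bump_out// scale0r addr0.
have phi_in x : `|x - p| <= rho - e -> phi x = Phi x.
  by move=> x1; rewrite /phi /chi bump_in// scale1r addrC subrK.
(* Contracted towards p by chi, the identity and phi coincide on K. *)
have phi1E x : K x -> phi1 x = phi x + chi x *: (p - phi x).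
  move=> Kx; have [x1|/ltW x1] := leP (rho - e) `|x - p|.
    by rewrite phi_out.
  by rewrite phi_in// /phi1 /chi bump_in// !scale1r ![_ + (p - _)]addrC !subrK.
have PhiC x : C (Phi x) by have [[]] := PhiU x.
have phiC x : K x -> C (phi x).
  move=> Kx; have [x1|/ltW x1] := leP (rho - e) `|x - p|.
    by rewrite phi_out//; exact: KC.
  by rewrite phi_in.
exists (phi @` K); split.
- by apply: continuous_compact => //; exact: continuous_subspaceT.
- by move=> _ [x Kx <-]; exact: phiC.
- move=> _ [x Kx <-]; rewrite balls_union_cat.
  have [x1|/ltW x1] := leP (rho - e) `|x - p|.
    by left; rewrite phi_out//; exact: Krest.
  by right; rewrite phi_in//; have [_] := PhiU x.
move=> l [F [cF FU Fid]].
have phil x : K x -> (C `&` balls_union l) (phi x).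
  by move=> Kx; rewrite -[phi x]Fid//; exists x.
have oU : open (C `&` balls_union (h ++ l)).
  by apply: openI => //; exact: open_balls_union.
have cone y u : C y -> balls_union (inner ++ n) y -> `|y - p| <= T ->
    0 <= u <= 1 -> (C `&` balls_union (h ++ l)) (p + u *: (y - p)).
  move=> Cy yU yT u01; split; first exact: cC.
  by rewrite balls_union_cat; left; exact: hcone.
have inl y : (C `&` balls_union l) y -> (C `&` balls_union (h ++ l)) y.
  by move=> [Cy ly]; split => //; rewrite balls_union_cat; right.
have pE (y : B) (u : R) : y + u *: (p - y) = p + (1 - u) *: (y - p).
  have -> : p + (1 - u) *: (y - p) = p + (y - p) - u *: (y - p).
    by rewrite scalerBl scale1r addrA.
  by rewrite [p + (y - p)]addrC subrK -scalerN opprB.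
apply: (@extends_into_homotopy _ _ K _ id phi1) => //.
- by move=> x; exact: cvg_id.
- move=> x t Kx /andP[t0 t1].
  have -> : x + t *: (phi1 x - x) = p + (1 - t * chi x) *: (x - p).
    by rewrite -pE /phi1 [x + _ *: (p - x)]addrC addrK scalerA.
  have /andP[c0 c1] := bump01 p rho e x.
  have [x1|x1] := leP rho `|x - p|.
    rewrite /chi bump_out// mulr0 subr0 scale1r addrC subrK.
    have phix : phi x = x.
      by apply: phi_out => //; rewrite (le_trans _ x1)// gerBl ltW.
    by apply: inl; rewrite -phix; exact: phil.
  apply: cone.
  + exact: KC.
  + by rewrite balls_union_cat; left; apply: Kin => //; exact: ltW.
  + by apply: ltW; exact: lt_trans rhoT.
  + rewrite subr_ge0 gerBl mulr_ge0// ?andbT.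
    by rewrite -[leRHS]mulr1 ler_pM.
apply: (@extends_into_homotopy _ _ K _ phi1 phi) => //.
- move=> x t Kx /andP[t0 t1].
  have -> : phi1 x + t *: (phi x - phi1 x) =
      p + (1 - (1 - t) * chi x) *: (phi x - p).
    rewrite -pE phi1E//; move: (phi x) => y.
    rewrite -scalerA; move: (chi x *: (p - y)) => v.
    by rewrite opprD addrA subrr add0r scalerN -addrA scalerBl scale1r.
  have /andP[c0 c1] := bump01 p rho e x.
  have [x1|x1] := leP rho `|x - p|.
    rewrite /chi bump_out// mulr0 subr0 scale1r addrC subrK.
    by apply: inl; exact: phil.
  apply: cone.
  + exact: phiC.
  + rewrite balls_union_cat; have [x2|/ltW x2] := leP (rho - e) `|x - p|.
      by left; rewrite phi_out//; apply: Kin => //; exact: ltW.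
    by right; rewrite phi_in//; have [_] := PhiU x.
  + have [x2|/ltW x2] := leP (rho - e) `|x - p|.
      by rewrite phi_out// ltW// (lt_trans x1).
    rewrite phi_in//; have [[_]] := PhiU x.
    by rewrite -ball_normE /ball_ /= distrC => /ltW.
  + rewrite subr_ge0 gerBl mulr_ge0// ?subr_ge0// ?andbT.
    by rewrite -[leRHS]mulr1 ler_pM// ?subr_ge0// gerBl.
exists (F \o phi); split.
- by move=> x; apply: continuous_comp; [exact: cphi | exact: cF].
- by move=> x; apply: inl; exact: FU.
- by move=> x Kx; rewrite /= Fid//; exists x.
Qed.

(** In a normed space this says that the open ball b meets the open ball of
    radius t about p. *)
Definition touches p (t : R) (b : B * R) : bool := `|b.1 - p| - b.2 < t.

Definition within_ball p (t : R) (b : B * R) : bool := `|b.1 - p| + b.2 <= t.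

(** A ball of radius r is cut by the collar for radii rho in an interval of
    length 2r + d, so the (m-1)-weights integrate to twice the m-weight plus
    a term that a small collar width d makes negligible. *)
Lemma thin_cut s p m (G T lam e : R) :
  pos_radii s -> 1 < lam -> 0 < T -> 0 < e ->
  weight m [seq b <- s | touches p (lam * T) b] < G ->
  exists rho d, [/\ T <= rho < lam * T, 0 < d <= e &
    weight (m - 1) [seq b <- s | touches p rho b && ~~ within_ball p (rho - d) b]
      <= 2 * G / ((lam - 1) * T)].
Proof.
move=> ps lam1 T0 e0; set A := [seq b <- s | _] => AG.
pose d := Num.min e ((G - weight m A) / (weight (m - 1) A + 1)).
have W1 : 0 < weight (m - 1) A + 1 by rewrite ltr_wpDl// weight_ge0.
have d0 : 0 < d by rewrite lt_min e0 divr_gt0// subr_gt0.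
have dW : d * weight (m - 1) A <= G - weight m A.
  apply: (@le_trans _ _ (d * (weight (m - 1) A + 1))).
    by rewrite ler_pM2l// lerDl.
  by rewrite -ler_pdivlMr// ge_min lexx orbT.
have pA : pos_radii A by exact: pos_radii_filter.
have [||||rho rhoT rhoM] := @interval_pigeonhole R _ A (fun b => b.2 `^ (m - 1))
   (fun b => `|b.1 - p| - b.2) (fun b => `|b.1 - p| + b.2 + d) T (lam * T)
   (2 * G / ((lam - 1) * T)).
- by rewrite ltr_pMl.
- by move=> b; exact: powR_ge0.
- by move=> b /pA b0; lra.
- rewrite (_ : lam * T - T = (lam - 1) * T); last by ring.
  rewrite divfK; last by rewrite gt_eqF// mulr_gt0// subr_gt0.
  rewrite (_ : \sum_(i <- A) _ = 2 * weight m A + d * weight (m - 1) A).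
    lra.
  rewrite /weight !mulr_sumr -big_split/=.
  rewrite big_seq [RHS]big_seq; apply: eq_bigr => b /pA b0.
  have -> : b.2 `^ m = b.2 `^ (m - 1) * b.2.
    by rewrite -[X in _ * X]powRr1 ?(ltW b0)// -gt0_powRD// subrK.
  by ring.
exists rho, d; split => //.
  by rewrite d0 ge_min lexx.
apply: le_trans rhoM.
rewrite /weight big_filter /A big_filter_cond le_eqVlt; apply/orP; left.
apply/eqP; apply: eq_bigl => b.
have /andP[_ rhoT1] := rhoT.
rewrite /touches /within_ball -ltNge [X in _ && X]ltrBlDr.
case: (ltP (`|b.1 - p| - b.2) rho) => lt /=; last by rewrite andbF.
by rewrite (lt_trans lt rhoT1).
Qed.

(** What surgery in dimension m asks of dimension m - 1: a set covered by
    balls of (m-1)-weight small compared with G^((m-1)/m) is filled at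
    m-weight th G. The first conclusion ensures that the cut balls, which
    survive the surgery, are a small part of the weight at stake. *)
Definition slice_filling (m b th : R) := forall (G : R) s,
  0 < G -> pos_radii s -> (forall c, c \in s -> c.2 `^ m <= G) ->
  weight (m - 1) s <= b * G `^ ((m - 1) / m) ->
  weight m s <= th * G /\
  forall C p D K, convex_nbhd C p D -> compact K -> K `<=` C ->
    K `<=` balls_union s ->
    exists n, [/\ pos_radii n, weight m n <= th * G & fillable C K n].

(** With T1 = lam T and G = (a T1)^m, the choice of T makes the balls near
    the centre weigh less than G in all and at least lam^-m G within radius
    T. At most a fifth of lam^-m G is cut, so the weight removed is at least
    4/5 of lam^-m G, and the new balls weigh at most a quarter of that.
    Cones have length at most T1, which is at most (lam/a) V^(1/m). *)
Lemma surgery m (a lam : R) C q D K s (V : R) (b0 : B * R) z :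
  0 < m -> 0 < a <= 3^-1 -> 1 < lam ->
  slice_filling m (2 * a * (lam / (lam - 1))) (lam `^ (- m) / 5) ->
  convex_nbhd C q D -> compact K -> K `<=` C -> K `<=` balls_union s ->
  pos_radii s -> weight m s <= V -> b0 \in s -> K z -> `|z - b0.1| < b0.2 ->
  exists (P : pred (B * R)) n h K',
    [/\ P b0, pos_radii n, weight m n <= weight m [seq b <- s | P b] / 4,
        pos_radii h /\ weight (m + 1) h <=
          2 * (lam `^ (m + 1)) ^+ 2 * (lam / (lam - 1)) / a * V `^ m^-1 *
          (weight m [seq b <- s | P b] - weight m n) &
     [/\ compact K', K' `<=` C,
        K' `<=` balls_union ([seq b <- s | ~~ P b] ++ n) &
        forall l, fillable C K' l -> fillable C K (h ++ l)] ].
Proof.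
move=> m0 /andP[a0 a3] lam1 slice convC cK KC Ks ps sV b0s Kz zb0.
have lam0 : 0 < lam by lra.
have r0 : 0 < b0.2 by exact: ps.
pose v (t : R) := weight m [seq b <- s | touches z (t / a) b].
have vV t : v t <= V.
  apply: le_trans sV; rewrite [leRHS](weight_filterC _ (fun b => touches z (t / a) b)).
  by rewrite lerDl weight_ge0.
(* At radius 3 r the ball b0 is well inside, since z lies in b0 and the collar is
   at most r wide; and b0 alone weighs enough because 3 a <= 1. *)
have start : (a * (3 * b0.2)) `^ m <= v (a * (3 * b0.2)).
  rewrite /v mulrC mulfK ?gt_eqF//.
  apply: (@le_trans _ _ (b0.2 `^ m)).
    rewrite powR_ler ?(ltW r0)// ?mulr_ge0 ?(ltW a0) ?(ltW r0)//.
    have : a * (3 * b0.2) <= 3^-1 * (3 * b0.2) by rewrite ler_wpM2r// mulr_ge0// ltW.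
    lra.
  apply: le_weight_mem; rewrite mem_filter b0s andbT /touches distrC.
  lra.
have start0 : 0 < a * (3 * b0.2) by rewrite !mulr_gt0.
have [aT [T3 dense sparse]] := last_dense_scale R v m lam _ V m0 lam1 start0 vV start.
have [T aTE] : exists T, aT = a * T.
  by exists (aT / a); rewrite mulrC divfK// gt_eqF.
have T3' : 3 * b0.2 <= T by rewrite -(ler_pM2l a0) -aTE.
have T0 : 0 < T by apply: lt_le_trans T3'; rewrite mulr_gt0.
rewrite aTE in dense sparse; clear T3.
pose T1 := lam * T.
have T10 : 0 < T1 by rewrite mulr_gt0.
pose G := (a * T1) `^ m.
have G0 : 0 < G by rewrite powR_gt0// mulr_gt0.
have touchedG : weight m [seq b <- s | touches z T1 b] < G.
  by move: sparse; rewrite /v mulrCA -/T1 mulrAC divff ?gt_eqF// mul1r.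
have denseG : lam `^ (- m) * G <= weight m [seq b <- s | touches z T b].
  move: dense; rewrite /v mulrAC divff ?gt_eqF// mul1r; apply: le_trans.
  have aT0 : 0 <= a * T by rewrite mulr_ge0// ltW.
  rewrite /G /T1 mulrCA (powRM _ (ltW lam0) aT0).
  by rewrite mulrA -(gt0_powRD _ _ _ _ lam0) addNr powRr0 mul1r.
have [rho [d [/andP[Trho rhoT1] /andP[d0 dr0] cutM]]] :=
  thin_cut s z m G T lam b0.2 ps lam1 T0 r0 touchedG.
set cut := [seq b <- s | _] in cutM.
have pcut : pos_radii cut by exact: pos_radii_filter.
have le_touched b : b \in s -> touches z T1 b -> b.2 `^ m <= G.
  move=> bs tb; apply: le_trans (ltW touchedG); apply: le_weight_mem.
  by rewrite mem_filter tb.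
have cutG b : b \in cut -> b.2 `^ m <= G.
  rewrite mem_filter => /andP[/andP[tb _] bs]; apply: le_touched => //.
  exact: lt_trans tb rhoT1.
have cutM' : weight (m - 1) cut <= 2 * a * (lam / (lam - 1)) * G `^ ((m - 1) / m).
  apply: le_trans cutM _.
  have aT10 : 0 < a * T1 by rewrite mulr_gt0.
  have -> : G `^ ((m - 1) / m) = (a * T1) `^ (m - 1).
    by rewrite /G -powRrM [m * _]mulrCA divff ?mulr1// gt_eqF.
  have -> : G = (a * T1) `^ (m - 1) * (a * T1).
    by rewrite -[X in _ * X]powRr1 ?(ltW aT10)// -gt0_powRD// subrK.
  move: (_ `^ (m - 1)) => W; rewrite /T1 le_eqVlt; apply/orP; left; apply/eqP.
  by field; rewrite ?gt_eqF//= subr_gt0.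
have [cutth fill] := slice G cut G0 pcut cutG cutM'.
set th := lam `^ (- m) / 5 in cutth fill.
have clK : closed K by apply: compact_closed => //; exact: norm_hausdorff.
pose Z := K `&` [set x | rho - d <= `|x - z| <= rho].
have cZ : compact Z.
  apply: (subclosed_compact _ cK); last by move=> x [].
  apply: closedI => //.
  have cd : continuous (fun x : B => `|x - z|).
    by move=> x; apply: cvg_norm; apply: cvgB; [exact: cvg_id|exact: cvg_cst].
  rewrite (_ : [set x | _] = (fun x => `|x - z|) @^-1` `[rho - d, rho]%classic).
    by apply: (closed_comp _ (interval_closed _ _)) => // x _; exact: cd.
  by apply/seteqP; split => x; rewrite /= in_itv.
have [oC cC _ _] := convC.
(* Filling inside this convex set keeps the new balls within reach of short cones. *)
have convC1 := convex_nbhd_ball C z T1 oC cC (KC _ Kz) T10.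
have dist_touch x b t : `|x - b.1| < b.2 -> `|x - z| <= t -> touches z t b.
  move=> xb xt; rewrite /touches ltrBlDr.
  by apply: le_lt_trans (ler_distD x _ _) _; rewrite (distrC b.1 x); lra.
have dist_within x b t : `|x - b.1| < b.2 -> within_ball z t b -> `|x - z| < t.
  move=> xb; rewrite /within_ball; apply: lt_le_trans.
  by apply: le_lt_trans (ler_distD b.1 _ _) _; lra.
have Zn : Z `<=` balls_union cut.
  move=> x [Kx /= /andP[x1 x2]]; have [b bs xb] := Ks x Kx.
  exists b => //; rewrite mem_filter bs andbT (dist_touch x)//=.
  by apply/negP => /(dist_within x _ _ xb); rewrite ltNge x1.
have ZC : Z `<=` C `&` ball z T1.
  move=> x [Kx /= /andP[x1 x2]]; split; first exact: KC.
  by rewrite -ball_normE /ball_ /= distrC (le_lt_trans x2).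
have [n [pn nth fn]] := fill (C `&` ball z T1) z T1 Z convC1 cZ ZC Zn.
(* The balls that disappear are those contained in the inner sphere of the collar. *)
pose P := within_ball z (rho - d).
pose x := weight m [seq b <- s | P b].
have Gx : lam `^ (- m) * G <= x + th * G.
  apply: le_trans denseG _; apply: le_trans (lerD (lexx x) cutth).
  rewrite (weight_filterC _ P) -filter_predI -filter_predI lerD//.
    by apply: le_weight_filter => b /andP[].
  apply: le_weight_filter => b /= /andP[-> tb]; rewrite andbT.
  exact: lt_le_trans tb Trho.
have lamm0 : 0 < lam `^ (- m) by rewrite powR_gt0.
have th0 : 0 < th by rewrite divr_gt0.
have thE : lam `^ (- m) = 5 * th by rewrite /th mulrC divfK.
have nx : weight m n <= x / 4.
  by apply: le_trans nth _; move: Gx; rewrite thE; lra.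
have rT1 c : c \in [seq b <- s | touches z T1 b] ++ n -> c.2 <= T1.
  move=> cs; have c0 : 0 < c.2.
    by move: cs; rewrite mem_cat => /orP[|/pn//]; rewrite mem_filter => /andP[_ /ps].
  have aT1 : a * T1 <= T1 by rewrite ger_pMl//; lra.
  apply: le_trans aT1; rewrite -(powR_ler _ _ _ m m0) ?(ltW c0)//; last first.
    by rewrite mulr_ge0// ltW.
  move: cs; rewrite mem_cat => /orP[|cn].
    by rewrite mem_filter => /andP[tc cs]; exact: le_touched.
  apply: le_trans (le_weight_mem m n c cn) _; apply: le_trans nth _.
  rewrite -/G ger_pMl//.
  have : lam `^ (- m) <= 1 by rewrite -(powRr0 lam) ler_powR ?ltW//; lra.
  rewrite thE; lra.
have pT : pos_radii ([seq b <- s | touches z T1 b] ++ n).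
  by apply: pos_radii_cat => //; exact: pos_radii_filter.
have [h [ph wh ch]] := cone_over_balls _ z T1 lam m pT rT1 lam1.
have [||K' [cK' K'C K'U K'fill]] := @replace_inside C K z q D rho d T1
  [seq b <- s | touches z T1 b] n [seq b <- s | ~~ P b] h convC cK KC (KC _ Kz) d0 rhoT1 _ _ fn ch.
- move=> y Ky yr; have [b bs yb] := Ks y Ky; exists b => //.
  by rewrite mem_filter bs andbT; apply: (dist_touch y) => //; exact/ltW/(le_lt_trans yr).
- move=> y Ky yr; have [b bs yb] := Ks y Ky; exists b => //.
  rewrite mem_filter bs andbT; apply/negP => /(dist_within y _ _ yb).
  by rewrite ltNge yr.
exists P, n, h, K'; split => //.
  rewrite /P /within_ball distrC; lra.
split => //; rewrite -/x.
apply: le_trans wh _.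
rewrite weight_cat.
have T1V : a * T1 <= lam * V `^ m^-1.
  rewrite /T1 mulrCA ler_pM2l// -(powR_ler _ _ _ m m0) ?powR_ge0//; last first.
    by rewrite mulr_ge0// ltW.
  rewrite -powRrM mulVf ?gt_eqF// powRr1.
    by apply: le_trans dense _.
  by apply: le_trans sV; exact: weight_ge0.
have G1 : G = lam `^ m * (lam `^ (- m) * G).
  by rewrite mulrA -gt0_powRD// subrr powRr0 mul1r.
have Wx : weight m [seq b <- s | touches z T1 b] + weight m n
    <= lam `^ m * (2 * (x - weight m n)).
  have : G + th * G <= lam `^ m * (6 * (th * G)) .
    have le1 : 1 <= lam `^ m by rewrite -(powRr0 lam) ler_powR ?ltW.
    rewrite {1}G1 thE.
    have : th * G <= lam `^ m * (th * G) by rewrite ler_peMl// mulr_ge0// ltW.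
    lra.
  move=> H; apply: le_trans (lerD (ltW touchedG) nth) _; apply: le_trans H _.
  rewrite ler_pM2l ?powR_gt0//.
  by move: Gx nx; rewrite thE; lra.
have k0 : 0 <= lam `^ (m + 1) by exact: powR_ge0.
have l1 : 0 <= lam / (lam - 1) by rewrite divr_ge0 ?subr_ge0 ?ltW.
apply: (@le_trans _ _ (lam `^ (m + 1) * (T1 * (lam / (lam - 1))) *
   (lam `^ m * (2 * (x - weight m n))))).
  apply: ler_wpM2l; last exact: Wx.
  by apply: mulr_ge0 => //; apply: mulr_ge0 => //; exact: ltW.
have -> : 2 * lam `^ (m + 1) ^+ 2 * (lam / (lam - 1)) / a * V `^ m^-1 * (x - weight m n)
   = lam `^ (m + 1) * ((lam * V `^ m^-1 / a) * (lam / (lam - 1))) *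
   (lam `^ m * (2 * (x - weight m n))).
  have -> : lam `^ (m + 1) = lam `^ m * lam.
    by rewrite gt0_powRD// powRr1// ltW.
  by field; rewrite ?gt_eqF//= subr_gt0.
rewrite ler_wpM2r//.
  rewrite mulr_ge0 ?powR_ge0// mulr_ge0//.
  have := weight_ge0 m n; lra.
rewrite ler_wpM2l// ler_wpM2r// ler_pdivlMr// mulrC//.
Qed.
End surgery.

(** * Iterating surgeries *)

Section iteration.
Context {R : realType} {B : completeNormedModType R}.
Implicit Types (C K Z : set B) (p q x : B) (s n h l : seq (B * R)) (m : R).

Definition covered C K s :=
  [/\ compact K, K `<=` C, K `<=` balls_union s & pos_radii s].

(** Filling K' and the balls h together fills K, and h has been paid for by
    the decrease of the weight; the costs of successive reductions therefore
    telescope. *)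
Definition reduces m (kap : R) C K s K' s' :=
  covered C K' s' /\
  exists h, [/\ pos_radii h,
    weight (m + 1) h <= kap * (weight m s - weight m s') &
    forall l, fillable C K' l -> fillable C K (h ++ l)].

Lemma reduces_refl m kap C K s : covered C K s -> reduces m kap C K s K s.
Proof.
by move=> cov; split => //; exists [::]; split => //; rewrite /weight big_nil subrr mulr0.
Qed.

Lemma reduces_trans m kap C K1 s1 K2 s2 K3 s3 :
  reduces m kap C K1 s1 K2 s2 -> reduces m kap C K2 s2 K3 s3 ->
  reduces m kap C K1 s1 K3 s3.
Proof.
move=> [_ [h [ph wh fh]]] [cov [h' [ph' wh' fh']]]; split => //.
exists (h ++ h'); split; first exact: pos_radii_cat.
  by rewrite weight_cat; lra.
by move=> l fl; rewrite -catA; apply: fh; exact: fh'.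
Qed.

Lemma reduces_weight m kap C K s K' s' : 0 < kap ->
  reduces m kap C K s K' s' -> weight m s' <= weight m s.
Proof.
move=> k0 [_ [h [_ wh _]]]; rewrite -subr_ge0 -(pmulr_rge0 _ k0).
by apply: le_trans wh; exact: weight_ge0.
Qed.

Definition surgery_cost m (a lam : R) : R :=
  2 * (lam `^ (m + 1)) ^+ 2 * (lam / (lam - 1)) / a.

Lemma surgery_cost_gt0 m (a lam : R) : 0 < a -> 1 < lam -> 0 < surgery_cost m a lam.
Proof.
move=> a0 lam1; have lam0 : 0 < lam by lra.
by rewrite /surgery_cost !mulr_gt0 ?invr_gt0 ?subr_gt0 ?exprn_gt0 ?powR_gt0.
Qed.

Section fixed_data.
Context (m a lam V D : R) (C : set B) (q : B).
Context (m0 : 0 < m) (a03 : 0 < a <= 3^-1) (lam1 : 1 < lam) (V0 : 0 < V).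
Context (slice :
  @slice_filling R B m (2 * a * (lam / (lam - 1))) (lam `^ (- m) / 5)).
Context (convC : convex_nbhd C q D).

Let kap := surgery_cost m a lam * V `^ m^-1.

Let kap0 : 0 < kap.
Proof.
by case/andP: a03 => a0 _; rewrite /kap mulr_gt0 ?powR_gt0// surgery_cost_gt0.
Qed.

(** The old balls o are removed one surgery at a time; every surgery adds at
    most a quarter of the weight that it removes to the new balls n, so in
    the end at most half of the weight of o has been added to n. Termination
    is by the number of old balls, however many new ones appear. *)
Lemma remove_old_balls o n K : covered C K (o ++ n) -> weight m (o ++ n) <= V ->
  exists K' s', reduces m kap C K (o ++ n) K' s' /\
    weight m s' <= weight m n + weight m o / 2.
Proof.
have [k] := ubnP (size o); elim: k => // k IH in o n K *.
case: o => [_ cov _|b0 o].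
  exists K, n; split; first exact: reduces_refl.
  by rewrite [X in _ + X / _]/weight big_nil mul0r addr0.
move=> ok cov sV.
have wo : weight m (b0 :: o) = b0.2 `^ m + weight m o by rewrite /weight big_cons.
have [cK KC Ks ps] := cov.
have [[z [Kz zb0]]|noz] := pselect (exists z, K z /\ `|z - b0.1| < b0.2); last first.
  have cov' : covered C K (o ++ n).
    split => //; last by move=> b bs; apply: ps; rewrite in_cons bs orbT.
    move=> x Kx; have [b + xb] := Ks x Kx.
    rewrite in_cons => /orP[/eqP bb0|bs]; last by exists b.
    by exfalso; apply: noz; exists x; rewrite -bb0.
  have w0 : weight m ((b0 :: o) ++ n) = b0.2 `^ m + weight m (o ++ n).
    by rewrite /= [LHS]/weight big_cons.
  have b00 : 0 <= b0.2 `^ m by exact: powR_ge0.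
  have [||K' [s' [[covK' [h [ph wh fh]]] ws']]] := IH o n K _ cov'.
  - by move: ok.
  - by move: sV; rewrite w0; lra.
  exists K', s'; split; last by rewrite wo; lra.
  split => //; exists h; split => //; apply: le_trans wh _.
  by rewrite ler_pM2l// w0; lra.
have b0s : b0 \in (b0 :: o) ++ n by rewrite mem_head.
have [P [n1 [h1 [K1 [Pb0 pn1 wn1 [ph1 wh1] [cK1 K1C K1U K1f]]]]]] :=
  surgery m a lam C q D K _ V b0 z m0 a03 lam1 slice convC cK KC Ks ps sV b0s Kz zb0.
pose o1 := [seq b <- b0 :: o | ~~ P b].
pose n2 := [seq b <- n | ~~ P b] ++ n1.
have sE : [seq b <- (b0 :: o) ++ n | ~~ P b] ++ n1 = o1 ++ n2.
  by rewrite filter_cat -catA.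
rewrite sE in K1U.
have fo := weight_filterC m P (b0 :: o); have fn := weight_filterC m P n.
rewrite filter_cat weight_cat in wn1 wh1.
have wE : weight m (o1 ++ n2) = weight m ((b0 :: o) ++ n)
    - (weight m [seq b <- b0 :: o | P b] + weight m [seq b <- n | P b]) + weight m n1.
  by rewrite /n2 !weight_cat fo fn /o1; ring.
have := weight_ge0 m [seq b <- b0 :: o | P b].
have := weight_ge0 m [seq b <- n | P b].
move=> wnP woP.
have step : reduces m kap C K ((b0 :: o) ++ n) K1 (o1 ++ n2).
  split.
    split => //; rewrite -sE; apply: pos_radii_cat => //.
    exact: pos_radii_filter.
  exists h1; split => //; apply: le_trans wh1 _.
  rewrite wE -/(surgery_cost m a lam) -/kap le_eqVlt; apply/orP; left; apply/eqP.
  by congr (_ * _); ring.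
have [||K' [s' [red ws']]] := IH o1 n2 K1 _ step.1.
- rewrite -ltnS; apply: leq_trans ok; rewrite ltnS /o1 /= Pb0 /=.
  by rewrite size_filter; exact: count_size.
- rewrite wE; lra.
exists K', s'; split; first exact: reduces_trans step red.
apply: le_trans ws' _; rewrite /n2 weight_cat fo fn -/o1.
by rewrite /o1; lra.
Qed.

Lemma reduce_to_small K s k : covered C K s -> weight m s <= V ->
  exists K' s', reduces m kap C K s K' s' /\ weight m s' <= V / 2 ^+ k.
Proof.
move=> cov sV; elim: k => [|k [K' [s' [red ws']]]].
  by exists K, s; split; [exact: reduces_refl | rewrite expr0 divr1].
have cov' : covered C K' (s' ++ [::]) by rewrite cats0; exact: red.1.
have [|K2 [s2 [red2 ws2]]] := remove_old_balls s' [::] K' cov'.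
  by rewrite cats0; apply: le_trans sV; exact: reduces_weight red.
rewrite cats0 in red2.
exists K2, s2; split; first exact: reduces_trans red red2.
apply: le_trans ws2 _; rewrite [X in X + _]/weight big_nil add0r exprSr invfM mulrA.
by rewrite ler_wpM2r// invr_ge0.
Qed.

End fixed_data.

(** The extra term e pays for a small ball around the vertex, which the cone
    itself misses when K is empty. *)
Lemma fill_by_cone m C q D K s (T : R) (e : R) :
  0 < m -> convex_nbhd C q D -> covered C K s -> D <= T ->
  (forall b, b \in s -> b.2 <= T) -> 0 < e ->
  exists h, [/\ pos_radii h, weight (m + 1) h <= 2 `^ (m + 1) * (T * 2) * weight m s + e &
    fillable C K h].
Proof.
move=> m0 [oC cC Cq CD] [cK KC Ks ps] DT sT e0.
have two1 : 1 < 2 :> R by rewrite ltr1n.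
have [h [ph wh ch]] := cone_over_balls s q T 2 m ps sT two1.
have r0 : 0 < e `^ (m + 1)^-1 by rewrite powR_gt0.
exists ((q, e `^ (m + 1)^-1) :: h); split.
- by move=> b; rewrite in_cons => /orP[/eqP->|/ph].
- rewrite /weight big_cons /= -/(weight _ _) addrC lerD//.
    apply: le_trans wh _; rewrite (_ : 2 - 1 = 1 :> R); last by ring.
    by rewrite divr1.
  by rewrite -powRrM mulVf ?powRr1 ?(ltW e0)// gt_eqF// addr_gt0.
have oU : open (C `&` balls_union ((q, e `^ (m + 1)^-1) :: h)).
  by apply: openI => //; exact: open_balls_union.
apply: (@extends_into_homotopy _ _ K _ id (fun=> q)) => //.
- by apply: compact_closed => //; exact: norm_hausdorff.
- by move=> x; exact: cvg_id.
- move=> x t Kx /andP[t0 t1]; split; first by apply: cC => //; [exact: KC|rewrite t0].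
  have -> : x + t *: (q - x) = q + (1 - t) *: (x - q).
    have -> : q + (1 - t) *: (x - q) = q + (x - q) - t *: (x - q).
      by rewrite scalerBl scale1r addrA.
    by rewrite [q + (x - q)]addrC subrK -scalerN opprB.
  have [||b bh xb] := ch x (1 - t) (Ks _ Kx).
  + by apply: le_trans DT; apply: CD; exact: KC.
  + by rewrite subr_ge0 t1 gerBl t0.
  by exists b => //; rewrite in_cons bh orbT.
exists (fun=> q); split => //; first by move=> x; exact: cvg_cst.
move=> _; split => //; exists (q, e `^ (m + 1)^-1); first exact: mem_head.
by rewrite /= subrr normr0.
Qed.

(** The convex set C localises the filling. In the inductive step C is
    intersected with a ball, which bounds the length of the cones over the
    filling of a slice. *)
Definition filling_bound m (c : R) := forall C p D K s (V : R),
  convex_nbhd C p D -> covered C K s -> 0 < V -> weight m s <= V ->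
  exists h, [/\ pos_radii h, weight (m + 1) h <= c * V `^ ((m + 1) / m) &
    fillable C K h].

(** The slack c - [surgery_cost] pays for the final cone, whose length is
    fixed by C in advance while the weight that remains can be made as small
    as desired. *)
Lemma filling_bound_of_slices m (a lam c : R) :
  0 < m -> 0 < a <= 3^-1 -> 1 < lam ->
  @slice_filling R B m (2 * a * (lam / (lam - 1))) (lam `^ (- m) / 5) ->
  surgery_cost m a lam < c -> filling_bound m c.
Proof.
move=> m0 a03 lam1 slice cc C p D K s V convC cov V0 sV.
have VV : 0 < V `^ ((m + 1) / m) by rewrite powR_gt0.
have [a0 _] := andP a03.
have k0 := surgery_cost_gt0 m a lam a0 lam1.
pose e := (c - surgery_cost m a lam) * V `^ ((m + 1) / m) / 2.
have e0 : 0 < e by rewrite divr_gt0// mulr_gt0// subr_gt0.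
pose T := Num.max D (V `^ m^-1).
have T0 : 0 < T by rewrite lt_max powR_gt0// orbT.
pose W := 2 `^ (m + 1) * (T * 2).
have W0 : 0 < W by rewrite !mulr_gt0// powR_gt0.
have [k kP] : exists k, V / 2 ^+ k <= e / W.
  have eW : 0 < e / W by exact: divr_gt0.
  have q0 : 0 <= V / (e / W) by apply: divr_ge0; exact: ltW.
  have /andP[_ kN] := truncn_itv q0.
  exists (Num.truncn (V / (e / W))).+1.
  rewrite ler_pdivrMr ?exprn_gt0// mulrC -(ler_pdivrMr _ _ eW).
  apply: le_trans (ltW kN) _.
  by rewrite -natrX ler_nat ltnW// ltn_expl.
have [K' [s' [[cov' [h [ph wh fh]]] ws']]] :=
  reduce_to_small m a lam V D C p m0 a03 lam1 V0 slice convC K s k cov sV.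
have [||h' [ph' wh' fh']] := fill_by_cone m C p D K' s' T e m0 convC cov' _ _ e0.
- by rewrite le_max lexx.
- move=> b bs; rewrite le_max; apply/orP; right.
  have b0 : 0 <= b.2 by apply: ltW; case: cov' => _ _ _ /(_ _ bs).
  rewrite -(powR_ler _ _ _ m m0) ?powR_ge0//.
  rewrite -powRrM mulVf ?gt_eqF// powRr1 ?(ltW V0)//.
  apply: le_trans (le_weight_mem m _ _ bs) _; apply: le_trans ws' _.
  rewrite ler_pdivrMr ?exprn_gt0// ler_peMr ?(ltW V0)//.
  by rewrite exprn_ege1// ler1n.
exists (h ++ h'); split; first exact: pos_radii_cat.
  rewrite weight_cat.
  have A : weight (m + 1) h <= surgery_cost m a lam * V `^ ((m + 1) / m).
    apply: le_trans wh _.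
    have -> : V `^ ((m + 1) / m) = V `^ m^-1 * V.
      have -> : (m + 1) / m = m^-1 + 1 by field; rewrite gt_eqF.
      by rewrite gt0_powRD// powRr1// ltW.
    rewrite mulrA ler_pM2l; last by rewrite mulr_gt0// powR_gt0.
    by have := weight_ge0 m s'; lra.
  have A' : W * weight m s' <= e.
    by rewrite mulrC -ler_pdivlMr//; apply: le_trans ws' kP.
  rewrite -/W in wh'.
  have : 2 * e = (c - surgery_cost m a lam) * V `^ ((m + 1) / m).
    by rewrite /e mulrC divfK.
  rewrite mulrBl => E2; lra.
exact: fh.
Qed.

End iteration.

(** * Induction on the dimension *)

Section constants.
Context {R : realType} {B : completeNormedModType R}.
Implicit Types (m : R) (s n h : seq (B * R)).

(** Since m - 1 <= 0 and r^m <= G, already one ball has (m-1)-weight at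
    least G^((m-1)/m); hence the family is empty. *)
Lemma slice_filling_low m (b th : R) :
  0 < m <= 1 -> b < 1 -> 0 < th -> @slice_filling R B m b th.
Proof.
move=> /andP[m0 m1] b1 th0 G s G0 ps sG sw.
have s0 : s = [::].
  case: s ps sG sw => // c s ps sG sw; exfalso.
  have c0 : 0 < c.2 by apply: ps; rewrite mem_head.
  have cG : c.2 <= G `^ m^-1.
    rewrite -(powR_ler _ _ _ m m0) ?powR_ge0 ?(ltW c0)//.
    by rewrite -powRrM mulVf ?gt_eqF// powRr1 ?(ltW G0)// sG// mem_head.
  have : G `^ ((m - 1) / m) <= c.2 `^ (m - 1).
    rewrite mulrC powRrM -(opprB 1 m) !powRN lef_pV2 ?posrE ?powR_gt0//.
    by rewrite ge0_ler_powR ?subr_ge0// ?nnegrE ?powR_ge0// ltW.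
  have := le_weight_mem (m - 1) (c :: s) c (mem_head _ _).
  have G1 : 0 < G `^ ((m - 1) / m) by rewrite powR_gt0.
  have : b * G `^ ((m - 1) / m) < G `^ ((m - 1) / m) by rewrite gtr_pMl.
  lra.
rewrite s0; split; first by rewrite /weight big_nil mulr_ge0// ltW.
move=> C p D K [_ _ Cp _] _ _ K0.
have r0 : 0 < (th * G) `^ m^-1 by rewrite powR_gt0// mulr_gt0.
exists [:: (p, (th * G) `^ m^-1)]; split.
- by move=> c; rewrite inE => /eqP ->.
- rewrite /weight big_seq1 /= -powRrM mulVf ?gt_eqF// powRr1//.
  by rewrite mulr_ge0// ltW.
exists (fun=> p); split.
- by move=> x; exact: cvg_cst.
- move=> _; split => //; exists (p, (th * G) `^ m^-1); first exact: mem_head.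
  by rewrite /= subrr normr0.
- by move=> x /K0[].
Qed.

(** The factor k^(m-1) is chosen to cancel the constant k^m of dimension m -
    1, since (k^(m-1))^(m/(m-1)) = k^m. *)
Lemma slice_filling_step m (k th : R) :
  1 < m -> 1 <= k -> 0 < th <= 1 -> @filling_bound R B (m - 1) (k `^ m) ->
  @slice_filling R B m (th / k `^ (m - 1)) th.
Proof.
move=> m1 k1 /andP[th0 th1] fb G s G0 ps sG sw.
have m0 : 0 < m by lra.
have m10 : 0 < m - 1 by lra.
have k0 : 0 < k by lra.
set b := th / _ in sw; set V := b * _ in sw.
have b0 : 0 < b by rewrite divr_gt0// powR_gt0.
have V0 : 0 < V by rewrite mulr_gt0// powR_gt0.
have kV : k `^ m * V `^ (m / (m - 1)) <= th * G.
  rewrite /V powRM ?powR_ge0 ?(ltW b0)// -powRrM.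
  rewrite (_ : (m - 1) / m * (m / (m - 1)) = 1); last by field; rewrite !gt_eqF.
  rewrite powRr1 ?(ltW G0)// mulrA ler_pM2r//.
  rewrite /b powRM ?invr_ge0 ?powR_ge0 ?(ltW th0)// -powRN -powRrM.
  rewrite (_ : - (m - 1) * (m / (m - 1)) = - m); last by field; rewrite gt_eqF.
  rewrite mulrCA -gt0_powRD// subrr powRr0 mulr1.
  apply: ge1r_powR; first by rewrite th0.
  by rewrite ler_pdivlMr// mul1r gerBl.
have k1m : 1 <= k `^ m by rewrite -(powRr0 k) ler_powR// ltW.
have mE : m - 1 + 1 = m by rewrite subrK.
split.
  apply: le_trans kV; apply: (@le_trans _ _ (V `^ (m / (m - 1)))); last first.
    by rewrite ler_peMl// powR_ge0.
  have -> : V `^ (m / (m - 1)) = V * V `^ (m - 1)^-1.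
    have -> : m / (m - 1) = 1 + (m - 1)^-1 by field; rewrite gt_eqF.
    by rewrite gt0_powRD// powRr1// ltW.
  apply: (@le_trans _ _ (weight (m - 1) s * V `^ (m - 1)^-1)); last first.
    by rewrite ler_wpM2r ?powR_ge0.
  rewrite /weight mulr_suml big_seq [leRHS]big_seq; apply: ler_sum => c cs.
  have c0 := ps _ cs.
  have -> : c.2 `^ m = c.2 `^ (m - 1) * c.2.
    by rewrite -{1}mE gt0_powRD// powRr1// ltW.
  rewrite ler_wpM2l ?powR_ge0// -(powR_ler _ _ _ (m - 1)) ?powR_ge0 ?(ltW c0)//.
  rewrite -powRrM mulVf ?gt_eqF// powRr1 ?(ltW V0)//.
  by apply: le_trans sw; exact: le_weight_mem.
move=> C p D K convC cK KC Ks.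
have [//|h [ph wh fh]] := fb C p D K s V convC _ V0 sw.
exists h; split => //; rewrite mE in wh.
exact: le_trans wh kV.
Qed.

Lemma exp1_le4 : expR 1 <= 4 :> R.
Proof.
have h : 2^-1 <= expR (- 2^-1) :> R.
  by apply: le_trans (expR_ge1Dx _); lra.
have : expR 2^-1 <= 2 :> R.
  by rewrite -[leLHS]invrK -expRN -[leRHS]invrK lef_pV2 ?posrE ?invr_gt0 ?expR_gt0.
move=> h2; have -> : 1 = 2^-1 + 2^-1 :> R by lra.
rewrite expRD; have := expR_gt0 (2^-1 : R) => h3.
apply: (@le_trans _ _ (2 * 2)); last lra.
by rewrite ler_pM// ltW.
Qed.

Lemma compound_le4 (x : R) : 0 < x -> (1 + x^-1) `^ x <= 4.
Proof.
move=> x0; apply: le_trans exp1_le4.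
have -> : expR 1 = expR x^-1 `^ x :> R by rewrite -expRM mulVf// gt_eqF.
rewrite ge0_ler_powR ?(ltW x0)//.
- by rewrite nnegrE addr_ge0// invr_ge0 ltW.
- by rewrite nnegrE expR_ge0.
- exact: expR_ge1Dx.
Qed.

Definition filling_const m : R := (100 * (m + 1)) `^ (m + 1).

Lemma filling_bound_low m : 0 < m <= 1 -> @filling_bound R B m (filling_const m).
Proof.
move=> m01; have /andP[m0 m1] := m01.
have two1 : 1 < 2 :> R by rewrite ltr1n.
(* For lam = 2 the slices have b = 4 a, and a = 1/5 makes it smaller than 1. *)
apply: (@filling_bound_of_slices R B m 5^-1 2) => //.
- by apply/andP; split; lra.
- apply: slice_filling_low => //.
  have -> : 2 - 1 = 1 :> R by lra.
  by rewrite divr1; lra.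
rewrite /surgery_cost /filling_const.
have -> : 2 * (2 `^ (m + 1)) ^+ 2 * (2 / (2 - 1)) / 5^-1 = 20 * 4 `^ (m + 1) :> R.
  have -> : 4 = 2 * 2 :> R by lra.
  by rewrite powRM//; field; rewrite ?andbT; lra.
apply: (@lt_le_trans _ _ (100 `^ (m + 1))); last first.
  rewrite ge0_ler_powR ?nnegrE//; lra.
have -> : 100 = 25 * 4 :> R by lra.
rewrite powRM// ltr_pM2r ?powR_gt0//.
apply: (@lt_le_trans _ _ 25); first lra.
by rewrite -[leLHS]powRr1// ler_powR//; lra.
Qed.

Lemma filling_bound_step m :
  1 < m -> @filling_bound R B (m - 1) (filling_const (m - 1)) ->
  @filling_bound R B m (filling_const m).
Proof.
move=> m1; rewrite /filling_const subrK => fb.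
have m0 : 0 < m by lra.
pose lam := 1 + (m + 1)^-1; pose th := lam `^ (- m) / 5.
pose k := 100 * m; pose b := th / k `^ (m - 1).
have lam1 : 1 < lam by rewrite ltrDl invr_gt0 addr_gt0.
have lam0 : 0 < lam by lra.
have k1 : 1 <= k by rewrite /k; lra.
have k0 : 0 < k by lra.
have lm1 : lam `^ (- m) <= 1 by rewrite -(powRr0 lam) ler_powR ?ltW//; lra.
have lm0 : 0 < lam `^ (- m) by rewrite powR_gt0.
have th01 : 0 < th <= 1 by rewrite /th; apply/andP; split; lra.
have [th0 _] := andP th01.
have km1 : 1 <= k `^ (m - 1) by rewrite -[leLHS](powRr0 k) ler_powR//; lra.
have km0 : 0 < k `^ (m - 1) by rewrite powR_gt0.
have b0 : 0 < b by rewrite divr_gt0.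
have b1 : b <= 1.
  by rewrite ler_pdivrMr// mul1r; case/andP: th01 => _ /le_trans; apply.
have lamE : lam / (lam - 1) = m + 2.
  by rewrite /lam; field; rewrite ?gt_eqF//; lra.
(* Since lam / (lam - 1) = m + 2, this a turns 2 a lam / (lam - 1) into b. *)
pose a := b / (2 * (m + 2)).
have a0 : 0 < a by rewrite divr_gt0//; lra.
apply: (@filling_bound_of_slices R B m a lam) => //.
- rewrite a0 /= ler_pdivrMr; last lra.
  by lra.
- rewrite lamE (_ : 2 * a * (m + 2) = b); last by rewrite /a; field; lra.
  exact: slice_filling_step.
rewrite /surgery_cost lamE.
set L := lam `^ (m + 1).
have L0 : 0 < L by rewrite powR_gt0.
have L4 : L <= 4 by apply: compound_le4; lra.
have L3 : L ^+ 3 <= 64.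
  have -> : 64 = 4 ^+ 3 :> R by rewrite -natrX.
  by rewrite lerXn2r// ?nnegrE ltW.
have lmL : lam `^ m <= L by rewrite ler_powR ?ltW//; lra.
have -> : 2 * L ^+ 2 * (m + 2) / a
    = 20 * (L ^+ 2 * lam `^ m) * (m + 2) ^+ 2 * k `^ (m - 1).
  rewrite /a /b /th powRN; field.
  by rewrite !gt_eqF//= ?powR_gt0//; lra.
have p0 : 0 < 100 * (m + 1) by lra.
have -> : (100 * (m + 1)) `^ (m + 1)
    = (100 * (m + 1)) ^+ 2 * (100 * (m + 1)) `^ (m - 1).
  have mE : m + 1 = m - 1 + 2%:R by ring.
  by rewrite {2}mE (gt0_powRD _ _ _ _ p0) powR_mulrn ?(ltW p0)// mulrC.
apply: (@lt_le_trans _ _ ((100 * (m + 1)) ^+ 2 * k `^ (m - 1))); last first.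
  rewrite (ler_pM2l (exprn_gt0 2 p0)).
  apply: ge0_ler_powR; rewrite ?nnegrE /k; lra.
rewrite (ltr_pM2r km0).
have h1 : L ^+ 2 * lam `^ m <= 64.
  apply: le_trans L3; rewrite (exprSr L 2); apply: ler_wpM2l => //.
  by rewrite exprn_ge0// ltW.
apply: (@le_lt_trans _ _ (20 * 64 * (m + 2) ^+ 2)).
  by apply: ler_wpM2r; [exact: sqr_ge0 | lra].
have h2 : 0 < (m - 1) ^+ 2 by rewrite exprn_gt0// subr_gt0.
by rewrite !expr2 in h2 *; lra.
Qed.

Lemma filling_bound_all m : 0 < m -> @filling_bound R B m (filling_const m).
Proof.
move=> m0; have /andP[_ mN] := truncn_itv (ltW m0).
have [N] : exists N, m <= N.+1%:R by exists (Num.truncn m); exact: ltW.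
elim: N => [|N IH] in m m0 {mN} *.
  by move=> m1; apply: filling_bound_low; rewrite m0.
move=> mN; have [m1|m1] := leP m 1; first by apply: filling_bound_low; rewrite m0.
apply: filling_bound_step => //; apply: IH; first lra.
by rewrite lerBlDr natr1.
Qed.

End constants.

(** * Hausdorff content *)

Section content.
Context {R : realType} {B : completeNormedModType R}.
Implicit Types (K : set B) (m : R) (s : seq (B * R)).

Lemma mdistE (x y : B) : mdist x y = `|y - x|.
Proof. by []. Qed.

Lemma weight_undup m s : weight m (undup s) <= weight m s.
Proof.
elim: s => [|b s IH] //=; rewrite [leRHS]/weight big_cons -/(weight _ _).
case: ifP => _; first by apply: le_trans IH _; rewrite lerDr powR_ge0.
by rewrite /weight big_cons lerD2l.
Qed.

Lemma hausdorff_content_le_weight m K s :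
  pos_radii s -> K `<=` balls_union s ->
  (hausdorff_content m K <= (weight m s)%:E)%E.
Proof.
move=> ps Ks; apply: (@le_trans _ _ (\esum_(b in [set` undup s]) ((b.2 `^ m)%:E)%E)).
  apply: ereal_inf_lbound; exists [set` undup s] => //; split.
  - by apply: finite_set_countable; exact: finite_seq.
  - by move=> b /=; rewrite mem_undup => /ps.
  - move=> z /Ks[b bs zb]; exists b; first by rewrite /= mem_undup.
    by rewrite /= mdistE ltW.
rewrite esum_fset; [|exact: finite_seq|by move=> b _; rewrite lee_fin powR_ge0].
rewrite -fsbig_seq ?undup_uniq// sumEFin lee_fin.
exact: weight_undup.
Qed.

(** Enlarging all radii by a factor lam makes the closed balls open at the
    cost of a factor lam^m in the sum, which the gap between the content and
    V absorbs. *)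
Lemma finite_cover_of_content m K (V : R) : 0 < m -> compact K ->
  (hausdorff_content m K < V%:E)%E ->
  exists s, [/\ pos_radii s, K `<=` balls_union s & weight m s <= V].
Proof.
move=> m0 cK /ereal_inf_lt[_ [C [cC Cpos KC] <-] EV].
have E0 : (0 <= \esum_(b in C) ((b.2 `^ m)%:E))%E.
  by apply: esum_ge0 => b _; rewrite lee_fin powR_ge0.
have [E EE] : exists E : R, \esum_(b in C) ((b.2 `^ m)%:E)%E = E%:E.
  exists (fine (\esum_(b in C) ((b.2 `^ m)%:E)%E)); rewrite fineK//.
  by rewrite ge0_fin_numE// (lt_trans EV)// ltry.
rewrite EE lte_fin in EV; rewrite EE lee_fin in E0.
have E'0 : 0 < (E + V) / 2 by lra.
pose lam := (V / ((E + V) / 2)) `^ m^-1.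
have q1 : 1 < V / ((E + V) / 2) by rewrite ltr_pdivlMr// mul1r; lra.
have q0 : 0 < V / ((E + V) / 2) by lra.
have lam0 : 0 < lam by rewrite powR_gt0.
have lamm : lam `^ m = V / ((E + V) / 2).
  by rewrite -powRrM mulVf ?gt_eqF// powRr1// ltW.
have lam1 : 1 < lam by rewrite -(powR_ltr _ _ _ m m0) ?ltW// lamm powR1.
move: cK; rewrite compact_cover.
move=> /(_ (B * R)%type C (fun b => ball b.1 (lam * b.2))).
case=> [b _||D DC KD]; first exact: ball_open.
  move=> z /KC[b Cb zb]; exists b => //; rewrite /= -ball_normE /ball_ /= distrC.
  by apply: le_lt_trans zb _; rewrite ltr_pMl// Cpos.
have DC' b : b \in finmap.enum_fset D -> C b by move=> /DC; rewrite inE.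
exists [seq (b.1, lam * b.2) | b <- finmap.enum_fset D]; split.
- by move=> _ /mapP[b /DC' Cb ->] /=; rewrite mulr_gt0// Cpos.
- move=> z /KD[b bD]; rewrite -ball_normE /ball_ /= distrC => zb.
  by exists (b.1, lam * b.2) => //; apply/mapP; exists b.
have DE : \sum_(b <- finmap.enum_fset D) b.2 `^ m <= E.
  rewrite -lee_fin -EE -sumEFin; apply: esum_ge.
  exists [set` finmap.enum_fset D].
    by split; [exact: finite_seq | move=> b /DC'].
  by rewrite -fsbig_seq//; exact: finmap.fset_uniq.
rewrite /weight big_map /= big_seq.
rewrite (eq_bigr (fun b => lam `^ m * b.2 `^ m)); last first.
  by move=> b /DC' Cb; rewrite powRM ?ltW// Cpos.
rewrite -big_seq -mulr_sumr; apply: (@le_trans _ _ (lam `^ m * ((E + V) / 2))).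
  by rewrite ler_pM2l ?powR_gt0//; lra.
by rewrite lamm divfK// gt_eqF.
Qed.

End content.

Theorem theorem1p1 (R : realType) (m : R) (m_gt0 : 0 < m) :
  exists2 const : R, const = (100 * (m + 1)) `^ (m + 1) &
  forall (B : completeNormedModType R) (X : metricType R)
    (Y : set X) (f : X -> B),
    closed Y -> {within Y, continuous f} -> compact (f @` Y) ->
    (filling (m + 1) Y [set: B] f <=
       const%:E * hausdorff_content m (f @` Y) `^ ((m + 1) / m))%E.
Proof.
exists ((100 * (m + 1)) `^ (m + 1)) => // B X Y f cY cf cfY.
rewrite -/(filling_const m).
have c0 : 0 < filling_const m.
  by rewrite powR_gt0// mulr_gt0// addr_gt0.
have k0 : 0 < (m + 1) / m by rewrite divr_gt0// addr_gt0.
have H0 : (0 <= hausdorff_content m (f @` Y))%E.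
  apply: le_ereal_inf_tmp => _ [C _ <-].
  by apply: esum_ge0 => b _; rewrite lee_fin powR_ge0.
case E : (hausdorff_content m (f @` Y)) H0 => [H||]//; last first.
  by rewrite poweRyr ?gt_eqF// gt0_muley ?lte_fin// ?leey.
rewrite lee_fin => H0; rewrite poweR_EFin -EFinM.
apply/lee_addgt0Pr => e e0; rewrite -EFinD.
(* V exceeds the content H by just enough for the bound to exceed its value by e. *)
pose W := H `^ ((m + 1) / m) + e / filling_const m.
have W0 : 0 < W by rewrite ltr_wpDl ?powR_ge0// divr_gt0.
pose V := W `^ ((m + 1) / m)^-1.
have V0 : 0 < V by rewrite powR_gt0.
have VW : V `^ ((m + 1) / m) = W.
  by rewrite -powRrM mulVf ?gt_eqF// powRr1// ltW.
have HV : H < V.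
  rewrite -(powR_ltr _ _ _ _ k0) ?(ltW V0)// VW /W ltrDl divr_gt0//.
have HV' : (hausdorff_content m (f @` Y) < V%:E)%E by rewrite E lte_fin.
have [s [ps Ks sV]] := finite_cover_of_content m _ V m_gt0 cfY HV'.
have [M M0 fM] := ex_strict_bound_gt0 (compact_bounded cfY).
have convC : convex_nbhd ([set: B] `&` ball 0 M) 0 M.
  by apply: convex_nbhd_ball => //; exact: openT.
have cov : covered ([set: B] `&` ball 0 M) (f @` Y) s.
  split=> // z Yz; split => //; rewrite -ball_normE /ball_ /= sub0r normrN.
  exact: fM.
have [h [ph wh [Phi [cPhi PhiU Phiid]]]] :=
  filling_bound_all m m_gt0 _ _ _ _ s V convC cov V0 sV.
have [F0 cF0 F0f] := compact_image_extension R B X Y f cY cf cfY.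
apply: (@le_trans _ _ (hausdorff_content (m + 1) (range (Phi \o F0)))).
  apply: ereal_inf_lbound; exists (Phi \o F0) => //; split => //.
  - by move=> x; apply: continuous_comp; [exact: cF0 | exact: cPhi].
  - by move=> y /set_mem Yy; rewrite /= F0f// Phiid//; exists y.
apply: (@le_trans _ _ (weight (m + 1) h)%:E).
  apply: hausdorff_content_le_weight => // _ [x _ <-].
  by have [_] := PhiU (F0 x).
rewrite lee_fin; apply: le_trans wh _.
by rewrite VW /W mulrDr [_ * (e / _)]mulrC divfK// gt_eqF.
Qed.
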